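(* Let $b,r\ge1$, let $S$ be a standard skew tableau with $b$ rows each of size $r$, let $k=\operatorname{stab}(S)$, and let $a\ge 2k-1$ be an integer. Then $R_a(S)$ is a standard Young tableau of rectangular shape $((ar)^b)$ and $\operatorname{pr}^{br}(R_a(S))=R_a(S)$.
   Context: Tableaux in English notation, rows indexed top to bottom. $\operatorname{Rect}$ is jeu de taquin rectification. For a skew tableau $U$ with $b$ rows, $\operatorname{Rect}^\ast(U)$ is obtained by repeatedly performing outer jeu de taquin slides inside a rectangle $(a'^b)$ containing $U$ until the cells occupied have complement a partition (pushed to the southeast corner); its row contents do not depend on $a'$. $U+x$ adds $x$ to each entry. For a standard skew tableau $S$ with $m$ cells whose row lengths weakly decrease from top to bottom and $k\ge1$, $S^{(k)}$ is obtained by attaching $k-1$ shifted copies of $S$ to the right of $S$: row $i$ of $S^{(k)}$ begins in the same column as row $i$ of $S$ and consists of the entries of row $i$ of $S$, followed by these entries plus $m$, ..., followed by these entries plus $(k-1)m$; $S^{(0)}$ is empty. $S$ stabilizes at $k$ if every entry in $[(k-1)m+1,km]$ lies in the same row of $\operatorname{Rect}(S^{(k)})$ as in $S^{(k)}$; $\operatorname{stab}(S)$ is the least such $k\ge1$. With $k=\operatorname{stab}(S)$ and $a\ge 2k-1$, $R_a(S)$ is the left-justified filling with $b$ rows whose $i$-th row is the concatenation of the $i$-th rows (entries read left to right) of $\operatorname{Rect}(S^{(k-1)})$, of $S^{(a-2k+2)}+(k-1)br$, and of $\operatorname{Rect}^\ast(S^{(k-1)})+(a-k+1)br$, in this order.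 Promotion $\operatorname{pr}$ on a standard tableau with $n$ cells: erase $1$, slide the empty cell by jeu de taquin until it reaches an outer corner, fill that corner with $n+1$, subtract $1$ from all entries. *)

(* Defs.v *)
From mathcomp Require Import all_boot.
Set Implicit Arguments. Unset Strict Implicit. Unset Printing Implicit Defensive.

(* A (skew) filling in English notation: a list of rows, top to bottom; row i
   is a list of cells from column 0 to column lambda_i - 1, where the first
   mu_i cells are empty (None, the inner shape) and the rest are filled
   (Some x). *)
Definition filling := seq (seq (option nat)).

Definition getT (T : filling) i j : option nat := nth None (nth [::] T i) j.
Definition setT (T : filling) i j v : filling :=
  set_nth [::] T i (set_nth None (nth [::] T i) j v).
Definition remove_cell (T : filling) i j : filling :=
  set_nth [::] T i (take j (nth [::] T i)).

Definition mu (row : seq (option nat)) : nat := find (fun o => isSome o) row.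
Definition entries (row : seq (option nat)) : seq nat := pmap id row.

Fixpoint slide (fuel : nat) (T : filling) (i j : nat) : filling * (nat * nat) :=
  match fuel with
  | 0 => (T, (i, j))
  | f.+1 =>
    match getT T i j.+1, getT T i.+1 j with
    | None, None => (T, (i, j))
    | Some x, None => slide f (setT T i j (Some x)) i j.+1
    | None, Some y => slide f (setT T i j (Some y)) i.+1 j
    | Some x, Some y =>
        if x < y then slide f (setT T i j (Some x)) i j.+1
        else slide f (setT T i j (Some y)) i.+1 j
    end
  end.

Definition fuelT (T : filling) := size T + sumn (map size T) + 1.

Fixpoint rect_fuel (fuel : nat) (T : filling) : filling :=
  match fuel with
  | 0 => T
  | f.+1 =>
    match [seq i <- iota 0 (size T) | 0 < mu (nth [::] T i)] with
    | [::] => T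
    | i0 :: idx =>
      let i := last i0 idx in
      let j := (mu (nth [::] T i)).-1 in
      let p := slide (fuelT T) T i j in
      rect_fuel f (remove_cell p.1 p.2.1 p.2.2)
    end
  end.

Definition count_inner (T : filling) := sumn (map (count (pred1 None)) T).

Definition Rect (T : filling) : seq (seq nat) :=
  map entries (rect_fuel (count_inner T).+1 T).

(* Rect^*(T): outer slides inside a rectangle (a'^b); implemented as: rotate
   the rectangle by 180 degrees and reverse the order of the entries (which
   turns outer slides into ordinary slides), rectify, rotate back.
   Returns the row contents, rows 0..b-1, read left to right. *)
Definition RectStar (T : filling) : seq (seq nat) :=
  let b := size T in
  let a' := foldr maxn 0 (map size T) in
  let M := (foldr maxn 0 (flatten (map entries T))).+1 in
  let U := rev [seq nseq (a' - size row) None ++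
                    map (fun x => Some (M - x)) (rev (entries row)) | row <- T] in
  let V := Rect U in
  [seq map (fun x => M - x) (rev (nth [::] V (b.-1 - i))) | i <- iota 0 b].

Definition is_std_skew (T : filling) : bool :=
  let w := flatten (map entries T) in
  [&& all (fun row => all (fun o => isSome o) (drop (mu row) row)) T,
      sorted (fun x y => y <= x) (map mu T),
      sorted (fun x y => y <= x) (map size T),
      perm_eq w (iota 1 (size w)),
      all (fun row => sorted ltn (entries row)) T &
      all (fun i => all (fun j =>
               match getT T i j, getT T i.+1 j with
               | Some x, Some y => x < y
               | _, _ => true
               end) (iota 0 (size (nth [::] T i.+1))))
          (iota 0 (size T))].

Definition is_SYT_rect (T : seq (seq nat)) (c b : nat) : bool :=
  is_std_skew (map (map Some) T) && (map size T == nseq b c).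

Definition ncells (S : filling) : nat := sumn (map (fun row => size (entries row)) S).

Definition rep_rows (S : filling) (k : nat) : seq (seq nat) :=
  [seq flatten [seq map (addn (j * ncells S)) (entries row) | j <- iota 0 k]
  | row <- S].

Definition Spow (S : filling) (k : nat) : filling :=
  [seq nseq (mu p.1) None ++ map Some p.2 | p <- zip S (rep_rows S k)].

Definition rowof (T : seq (seq nat)) (x : nat) : nat :=
  find (fun row => x \in row) T.

Definition stabilizes (S : filling) (k : nat) : bool :=
  all (fun x => rowof (Rect (Spow S k)) x == rowof (rep_rows S k) x)
      (iota ((k - 1) * ncells S).+1 (ncells S)).

(* R_a(S), with k = stab(S) passed explicitly *)
Definition Ra (a : nat) (S : filling) (k : nat) : seq (seq nat) :=
  let m := ncells S in
  [seq nth [::] (Rect (Spow S k.-1)) i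
       ++ map (addn (k.-1 * m)) (nth [::] (rep_rows S (a + 2 - 2 * k)) i)
       ++ map (addn ((a + 1 - k) * m)) (nth [::] (RectStar (Spow S k.-1)) i)
  | i <- iota 0 (size S)].

Definition pr (T : seq (seq nat)) : seq (seq nat) :=
  let n := sumn (map size T) in
  let To : filling := map (map Some) T in
  let p := slide (fuelT To) To 0 0 in
  let T' := setT p.1 p.2.1 p.2.2 (Some n.+1) in
  map (map (fun o => (odflt 0 o).-1)) T'.

(* Main.v *)
(** Record a standard skew tableau by its row word, whose x-th letter is the row
    of the entry x. A jeu de taquin slide changes the row word by crystal raising
    operators, so Rect becomes the passage to the highest weight word [hw] and
    Rect^* the passage to the lowest weight word [lw]. With w the word of S and
    K = k - 1, stabilization reads hw(w^K w) = hw(w^K) w, and the word of R_a(S)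
    is hw(w^K) w^(a-2K) lw(w^K).

    Promotion sends hw(xu) lw(v) to hw(u) lw(vx) whenever the shapes of the two
    factors are complementary in the rectangle, before and after. Starting from
    hw(w w^K) lw(w^(a-K-1)), the letters of w move one at a time from the left
    factor to the right one, and br promotions end at hw(w^K) lw(w^(a-K-1) w).
    Both words are R_a(S) by stabilization and its dual. The dual holds because
    the highest weight words of a word and of its rotation have the same content,
    while raising operators only decrease letters.

    Complementarity amounts to self-duality of the shape lam of hw(w^K). If c_p is
    the number of unmatched letters p + 1 in w, periodicity lets the row and column
    directions of the growth diagram be extremal independently, which gives
    lam_p - lam_(p+1) >= c_p + c_(b-2-p); rectifying w^K from the inner shape
    (sum_(q >= p) c_q)_p bounds the first row, and the total size forces equality. *)

Require Import Defs.
From Stdlib Require Import FunctionalExtensionality.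
From mathcomp Require Import all_boot.
From mathcomp Require Import zify.
Set Implicit Arguments. Unset Strict Implicit. Unset Printing Implicit Defensive.

(** * Raising operators on words *)

(* The maximal power of the raising operator e_i. Letters [i] open and letters
   [i.+1] close brackets, [c] brackets being open at the start; an unmatched
   [i.+1] becomes [i]. *)
Fixpoint raise (i c : nat) (u : seq nat) : seq nat :=
  match u with
  | [::] => [::]
  | x :: u' =>
    if x == i then i :: raise i c.+1 u'
    else if x == i.+1 then
      (if c is c'.+1 then i.+1 :: raise i c' u' else i :: raise i 0 u')
    else x :: raise i c u'
  end.

Fixpoint rstate (i c : nat) (u : seq nat) : nat :=
  match u with
  | [::] => c
  | x :: u' =>
    if x == i then rstate i c.+1 u'
    else if x == i.+1 then rstate i c.-1 u'
    else rstate i c u'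
  end.

(** Counted from the right: a letter [i] cancels one pending [i.+1], if there is any. *)
Fixpoint unmatched (i : nat) (u : seq nat) : nat :=
  match u with
  | [::] => 0
  | x :: u' =>
    if x == i then (unmatched i u').-1
    else if x == i.+1 then (unmatched i u').+1
    else unmatched i u'
  end.

Definition ct (u : seq nat) (q : nat) : nat := count_mem q u.

Lemma ct_cons x u q : ct (x :: u) q = (x == q) + ct u q.
Proof. by []. Qed.

Ltac decide_eqs :=
  rewrite /= ?ct_cons ?eqxx /=;
  repeat (
    match goal with
    | |- context [@eq_op _ ?x ?y] =>
        first [ rewrite (_ : (x == y) = false); last by lia
              | rewrite (_ : (x == y) = true); last by lia ]
    end; rewrite /= ?ct_cons ?eqxx /=).

(** The minimum of the two counters evolves like a single counter. For zero counters this is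
    idempotence. *)
Lemma raise_raise i c d u : raise i d (raise i c u) = raise i (minn c d) u.
Proof.
elim: u c d => [|x u IH] c d //=.
case: (eqVneq x i) => [_|ni] /=; first by rewrite eqxx IH minnSS.
case: (eqVneq x i.+1) => [_|ni1] /=.
  case: c => [|c] /=; first by rewrite eqxx IH !min0n.
  rewrite eqxx (_ : i.+1 == i = false); last by lia.
  by case: d => [|d]; rewrite ?minn0 ?minnSS IH ?minn0.
by rewrite (negbTE ni) (negbTE ni1) IH.
Qed.

Lemma raise_comm i j c d u : i.+1 < j ->
  raise i c (raise j d u) = raise j d (raise i c u).
Proof.
move=> ij; elim: u c d => [|x u IH] c d //=.
case: (eqVneq x i) => [->|ni]; first by (decide_eqs; rewrite IH).
case: (eqVneq x i.+1) => [->|ni1]; first by (case: c => [|c]; decide_eqs; rewrite IH).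
case: (eqVneq x j) => [->|nj]; first by (decide_eqs; rewrite IH).
case: (eqVneq x j.+1) => [->|nj1]; first by (case: d => [|d]; decide_eqs; rewrite IH).
by decide_eqs; rewrite IH.
Qed.

(* The counters of the two triple compositions determine each other by a
   piecewise-linear bijection, which each letter preserves. *)
Lemma raise_braid_state i a b c u :
  raise i c (raise i.+1 b (raise i a u)) =
  raise i.+1 (b + (a - c)) (raise i (minn a c) (raise i.+1 (b + (c - a)) u)).
Proof.
elim: u a b c => [|x u IH] a b c //.
case: (eqVneq x i) => [->|n0]; first by (decide_eqs; rewrite IH subSS minnSS).
case: (eqVneq x i.+1) => [->|n1].
  case: a => [|a].
    by rewrite min0n; decide_eqs; rewrite IH !(sub0n, subn0, min0n, addn0, addnS).
  case: c => [|c]; rewrite ?minn0 ?minnSS; decide_eqs; rewrite IH;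
    by rewrite ?subSS !(sub0n, subn0, minn0, addn0, addnS, addSn).
case: (eqVneq x i.+2) => [->|n2]; last by (decide_eqs; rewrite IH).
case: b => [|b]; last by (decide_eqs; rewrite IH).
case: c => [|c].
  by rewrite minn0 sub0n subn0 !add0n; decide_eqs; rewrite IH minn0 sub0n subn0.
case: (leqP a c) => ac.
  have -> : 0 + (c.+1 - a) = (c - a).+1 by lia.
  have -> : 0 + (a - c.+1) = 0 by lia.
  have -> : minn a c.+1 = a by lia.
  decide_eqs; rewrite IH; congr (_ :: raise _ _ (raise _ _ (raise _ _ _))); lia.
have -> : 0 + (c.+1 - a) = 0 by lia.
have -> : minn a c.+1 = c.+1 by lia.
decide_eqs; rewrite IH; congr (_ :: raise _ _ (raise _ _ (raise _ _ _))); lia.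
Qed.

Lemma raise_braid i u :
  raise i 0 (raise i.+1 0 (raise i 0 u)) =
  raise i.+1 0 (raise i 0 (raise i.+1 0 u)).
Proof. exact: raise_braid_state. Qed.

(** * Highest weight words through the longest permutation *)

Definition raises (s : seq nat) (u : seq nat) : seq nat :=
  foldr (fun i => raise i 0) u s.

Lemma raises_cat s1 s2 u : raises (s1 ++ s2) u = raises s1 (raises s2 u).
Proof. by rewrite /raises foldr_cat. Qed.

Definition descent n := rev (iota 0 n).

Lemma descentS n : descent n.+1 = n :: descent n.
Proof. by rewrite /descent -addn1 iotaD rev_cat. Qed.

(* A reduced word of the longest permutation of [n.+1] letters. *)
Fixpoint longest n : seq nat :=
  if n is m.+1 then longest m ++ descent m.+1 else [::].

Lemma raise_raises_descent j m u : m < j ->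
  raise j 0 (raises (descent m) u) = raises (descent m) (raise j 0 u).
Proof.
elim: m u => [|m IH] u mj //; rewrite descentS /= -IH //; last by lia.
by rewrite -raise_comm; last lia.
Qed.

(** The adjacent factors [i.+1], [i] of the descent let the generator pass by the braid relation,
    which lowers its index; the other factors commute with it. *)
Lemma raises_descentS m i u : i.+1 < m ->
  raises (descent m) (raise i.+1 0 u) = raise i 0 (raises (descent m) u).
Proof.
elim: m => [|m IH] // im; rewrite descentS.
move: im; rewrite ltnS leq_eqVlt => /orP[/eqP<-|im] /=.
  by rewrite descentS /= -raise_raises_descent // raise_braid.
by rewrite IH //= -raise_comm.
Qed.

Lemma raises_descent0 m u : 0 < m ->
  raises (descent m) (raise 0 0 u) = raises (descent m) u.
Proof.
elim: m => [|[|m] IH] // _; first by rewrite /= raise_raise.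
by rewrite descentS /= IH.
Qed.

(** The maps satisfy the relations of the 0-Hecke monoid, whose longest element absorbs every
    generator: index 0 is absorbed by the descent, index [i.+1] crosses it as [i] and is absorbed by
    [longest n]. *)
Lemma raises_longest_raise n i u : i < n ->
  raises (longest n) (raise i 0 u) = raises (longest n) u.
Proof.
elim: n i u => [|n IH] i u // ilt; rewrite /= !raises_cat.
case: i ilt => [|i] ilt; first by rewrite raises_descent0.
by rewrite raises_descentS // IH //; lia.
Qed.

Definition hw b u := raises (longest b.-1) u.

(** A partial raising [raise i c] is completed by [raise i 0], which [hw] absorbs. The later
    invariance properties of [hw] rest on this. *)
Lemma hw_raise b i c u : i.+1 < b -> hw b (raise i c u) = hw b u.
Proof.
move=> ib; have il : i < b.-1 by lia.
rewrite /hw -(raises_longest_raise (raise i c u) il) raise_raise minn0.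
exact: raises_longest_raise.
Qed.

Lemma size_raise i c u : size (raise i c u) = size u.
Proof.
elim: u c => [|x u IH] c //=; case: eqP => _; first by rewrite /= IH.
by case: eqP => _; case: c => [|c]; rewrite /= IH.
Qed.

Lemma size_raises s u : size (raises s u) = size u.
Proof. by elim: s => //= i s IH; rewrite size_raise. Qed.

Lemma size_hw b u : size (hw b u) = size u.
Proof. exact: size_raises. Qed.

Lemma raise_cat i c u v :
  raise i c (u ++ v) = raise i c u ++ raise i (rstate i c u) v.
Proof.
elim: u c => [|x u IH] c //=; case: eqP => _; first by rewrite IH.
by case: eqP => _; case: c => [|c]; rewrite /= IH.
Qed.

Lemma take_raise n i c u : take n (raise i c u) = raise i c (take n u).
Proof.
elim: u c n => [|x u IH] c [|n] //; first by rewrite !take0.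
rewrite /=; case: eqP => _; first by rewrite /= IH.
by case: eqP => _; case: c => [|c]; rewrite /= IH.
Qed.

Lemma take_raises n s u : take n (raises s u) = raises s (take n u).
Proof. by elim: s => //= i s IH; rewrite take_raise IH. Qed.

Lemma take_hw b n u : take n (hw b u) = hw b (take n u).
Proof. exact: take_raises. Qed.

Lemma raise_leq i c u t : nth 0 (raise i c u) t <= nth 0 u t.
Proof.
elim: u c t => [|x u IH] c t //=; case: eqP => [->|_]; first by case: t => //=.
by case: eqP => [->|_]; case: c t => [|c] [|t] //=.
Qed.

Lemma raises_leq s u t : nth 0 (raises s u) t <= nth 0 u t.
Proof. by elim: s => //= i s IH; apply: leq_trans IH; apply: raise_leq. Qed.

Lemma all_raise b i c u : all (gtn b) u -> all (gtn b) (raise i c u).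
Proof.
elim: u c => [|x u IH] c //= /andP[xb ub]; case: eqP xb => [->|_] xb /=.
  by rewrite xb IH.
by case: eqP xb => [->|_] xb; case: c => [|c] /=; rewrite IH ?andbT //= ltnW.
Qed.

Lemma all_raises b s u : all (gtn b) u -> all (gtn b) (raises s u).
Proof. by move=> ub; elim: s => //= i s; apply: all_raise. Qed.

Lemma all_hw b u : all (gtn b) u -> all (gtn b) (hw b u).
Proof. exact: all_raises. Qed.

Lemma ct_cat u v q : ct (u ++ v) q = ct u q + ct v q.
Proof. exact: count_cat. Qed.

Lemma rstate_count i c u : rstate i c u + ct (raise i c u) i.+1 = c + ct u i.
Proof.
elim: u c => [|x u IH] c; first by rewrite addnC.
case: (eqVneq x i) => [->|n0]; first by (decide_eqs; have := IH c.+1; lia).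
case: (eqVneq x i.+1) => [->|n1].
  case: c => [|c]; decide_eqs; first by (have := IH 0; lia).
  by have := IH c; lia.
by decide_eqs; have := IH c; lia.
Qed.

Lemma ct_raise i c u : ct (raise i c u) i = ct u i + (unmatched i u - c).
Proof.
elim: u c => [|x u IH] c //.
case: (eqVneq x i) => [->|n0]; first by (decide_eqs; rewrite IH; lia).
case: (eqVneq x i.+1) => [->|n1].
  by case: c => [|c]; decide_eqs; rewrite IH; lia.
by decide_eqs; rewrite IH; lia.
Qed.

Lemma ct_raiseS i c u : ct (raise i c u) i.+1 + (unmatched i u - c) = ct u i.+1.
Proof.
elim: u c => [|x u IH] c //.
case: (eqVneq x i) => [->|n0]; first by (decide_eqs; have := IH c.+1; lia).
case: (eqVneq x i.+1) => [->|n1].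
  case: c => [|c]; decide_eqs; first by (have := IH 0; lia).
  by have := IH c; lia.
by decide_eqs; have := IH c; lia.
Qed.

Lemma ct_raise_other i c u q : q != i -> q != i.+1 ->
  ct (raise i c u) q = ct u q.
Proof.
move=> q0 q1; elim: u c => [|x u IH] c //.
case: (eqVneq x i) => [->|n0]; first by (decide_eqs; rewrite IH).
case: (eqVneq x i.+1) => [->|n1]; last first.
  by rewrite /= (negbTE n0) (negbTE n1) !ct_cons IH.
by case: c => [|c]; decide_eqs; rewrite IH.
Qed.

Lemma unmatched_ge i u : ct u i.+1 <= unmatched i u + ct u i.
Proof.
elim: u => [|x u IH] //.
case: (eqVneq x i) => [->|n0]; first by (decide_eqs; lia).
by case: (eqVneq x i.+1) => [->|n1]; decide_eqs; lia.
Qed.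

Lemma longest_lt n : all (gtn n) (longest n).
Proof.
elim: n => [|n IH] //; rewrite [longest _]/= all_cat; apply/andP; split.
  by apply: sub_all IH => i /=; lia.
by apply/allP => i; rewrite /descent mem_rev mem_iota /=; lia.
Qed.

Lemma behead_raise i c u : exists c', behead (raise i c u) = raise i c' (behead u).
Proof.
case: u => [|x u] /=; first by exists 0.
case: eqP => _; first by exists c.+1.
case: eqP => _; last by exists c.
by case: c => [|c]; [exists 0 | exists c].
Qed.

(** Erasing the first letter only alters the initial counter of each raising, and [hw] ignores that
    counter. *)
Lemma hw_behead_raises b s u : all (gtn b.-1) s ->
  hw b (behead (raises s u)) = hw b (behead u).
Proof.
elim: s => //= i s IH /andP[ib sb]; case: (behead_raise i 0 (raises s u)) => c ->.
by rewrite hw_raise ?IH //; lia.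
Qed.

Lemma hw_behead b u : hw b (behead (hw b u)) = hw b (behead u).
Proof. exact/hw_behead_raises/longest_lt. Qed.

(** * Powers of a word and their stabilization *)

Definition pow N (w : seq nat) := flatten (nseq N w).

Lemma powS N w : pow N.+1 w = w ++ pow N w. Proof. by []. Qed.

Lemma powD N M w : pow (N + M) w = pow N w ++ pow M w.
Proof. by rewrite /pow nseqD flatten_cat. Qed.

Lemma pow1 w : pow 1 w = w. Proof. exact: cats0. Qed.

Lemma powSr N w : pow N.+1 w = pow N w ++ w.
Proof. by rewrite -addn1 powD pow1. Qed.

Lemma size_pow N w : size (pow N w) = N * size w.
Proof. by elim: N => //= N IH; rewrite powS size_cat IH mulSn. Qed.

Lemma all_pow (a : pred nat) N w : all a w -> all a (pow N w).
Proof. by move=> aw; elim: N => //= N IH; rewrite powS all_cat aw. Qed.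

Lemma ct_pow N w q : ct (pow N w) q = N * ct w q.
Proof. by elim: N => //= N IH; rewrite powS ct_cat IH mulSn. Qed.

Lemma raise_pow_fixed i c w N : raise i c w = w ->
  ct w i = ct w i.+1 -> raise i c (pow N w) = pow N w.
Proof.
move=> cw bal; have := rstate_count i c w; rewrite cw => rw.
by elim: N => // N IH; rewrite powS raise_cat cw (_ : rstate i c w = c) ?IH //; lia.
Qed.

(* Letters never increase along the composition, so a final block that comes out
   unchanged was left alone by every factor; being balanced, it returns every
   counter to its value. *)
Lemma raises_stable s u w N :
  {in s, forall i, ct w i = ct w i.+1} ->
  raises s (u ++ w) = raises s u ++ w ->
  raises s (u ++ pow N w) = raises s u ++ pow N w.
Proof.
elim/last_ind: s u => [|s i IH] u bal //.
rewrite -cats1 !raises_cat /= !raise_cat => fixw.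
have wi : raise i (rstate i 0 u) w = w.
  apply: (@eq_from_nth _ 0); first by rewrite size_raise.
  move=> t _; apply/eqP; rewrite eqn_leq raise_leq /=.
  have := raises_leq s (raise i 0 u ++ raise i (rstate i 0 u) w) (size u + t).
  have tl (v w' : seq nat) : size v = size u ->
    nth 0 (v ++ w') (size u + t) = nth 0 w' t.
    by move=> sv; rewrite nth_cat sv ltnNge leq_addr /= addKn.
  by rewrite fixw !tl ?size_raises ?size_raise.
rewrite raise_pow_fixed //; last by apply: bal; rewrite mem_rcons mem_head.
rewrite wi in fixw; apply: IH fixw => j js; apply: bal.
by rewrite mem_rcons in_cons js orbT.
Qed.

(** * Slides on row words *)

Definition dominant b (rho : nat -> nat) :=
  forall p, p.+1 < b -> rho p.+1 <= rho p.

Definition addc (rho : nat -> nat) x : nat -> nat := fun q => rho q + (x == q).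

Definition addw (rho : nat -> nat) u : nat -> nat := fun q => rho q + ct u q.

Lemma addw_nil rho : addw rho [::] = rho.
Proof. by apply: functional_extensionality => q; rewrite /addw addn0. Qed.

Lemma addw_cons rho x u : addw rho (x :: u) = addw (addc rho x) u.
Proof.
by apply: functional_extensionality => q; rewrite /addw /addc ct_cons addnA.
Qed.

Lemma addw_cat rho u v : addw rho (u ++ v) = addw (addw rho u) v.
Proof.
by apply: functional_extensionality => q; rewrite /addw ct_cat addnA.
Qed.

Lemma addcC rho x y : addc (addc rho x) y = addc (addc rho y) x.
Proof. by apply: functional_extensionality => q; rewrite /addc addnAC. Qed.

(* [u] adds cells one at a time to the shape [rho], staying a partition. *)
Fixpoint lattice b (rho : nat -> nat) (u : seq nat) : Prop :=
  dominant b rho /\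
  if u is x :: u' then x < b /\ lattice b (addc rho x) u' else True.

Lemma lattice_dominant b rho u : lattice b rho u -> dominant b rho.
Proof. by case: u => [|x u] []. Qed.

Lemma lattice_cat b rho u v :
  lattice b rho (u ++ v) <-> lattice b rho u /\ lattice b (addw rho u) v.
Proof.
elim: u rho => [|x u IH] rho /=.
  rewrite addw_nil; split=> [h|[]//]; split=> //; split=> //.
  exact: lattice_dominant h.
rewrite addw_cons; split=> [[d [xb /IH[h1 h2]]]|[[d [xb h1]] h2]] //.
by do 2!split=> //; apply/IH.
Qed.

Lemma lattice_end b rho u : lattice b rho u -> dominant b (addw rho u).
Proof. by rewrite -{1}(cats0 u) => /lattice_cat[_ /lattice_dominant]. Qed.

Lemma lattice_lt b rho u : lattice b rho u -> all (gtn b) u.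
Proof. by elim: u rho => //= x u IH rho [_ [-> /IH]]. Qed.

Lemma lattice_take b rho u n : lattice b rho u -> lattice b rho (take n u).
Proof. by rewrite -{1}(cat_take_drop n u) => /lattice_cat[]. Qed.

Lemma latticeP b rho u : all (gtn b) u ->
  (forall n, dominant b (addw rho (take n u))) -> lattice b rho u.
Proof.
elim: u rho => [|x u IH] rho /=.
  by move=> _ h; split=> //; have := h 0; rewrite addw_nil.
case/andP=> xb ub h; split; first by have := h 0; rewrite addw_nil.
by split=> //; apply: IH => // n; have := h n.+1; rewrite addw_cons.
Qed.

(** The counter always equals the difference in length of rows [p] and [p.+1] of the current shape,
    so it is positive whenever [p.+1] is read. *)
Lemma raise_id b p rho u : p.+1 < b -> lattice b rho u ->
  raise p (rho p - rho p.+1) u = u.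
Proof.
move=> pb; elim: u rho => [|x u IH] rho //= [d [xb h]].
have := IH _ h; have dp := lattice_dominant h pb; have d0 := d p pb.
move: dp; rewrite /addc.
case: (eqVneq x p) => [->|n0].
  by decide_eqs => _; rewrite addn0 addn1 subSn // => ->.
case: (eqVneq x p.+1) => [->|n1].
  decide_eqs; rewrite addn0 addn1 => lt e.
  by rewrite -[rho p - _]prednK ?subn_gt0 // -subnS e.
by rewrite !addn0 => _ ->.
Qed.

Lemma raises_id b s rho u : all (gtn b.-1) s -> (forall p, rho p = 0) ->
  lattice b rho u -> raises s u = u.
Proof.
move=> + r0 lu; elim: s => //= i s IH /andP[ib sb]; rewrite IH //.
have := @raise_id b i rho u; rewrite !r0; apply=> //; lia.
Qed.

Lemma hw_id b u : lattice b (fun=> 0) u -> hw b u = u.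
Proof. by apply: raises_id (longest_lt _) _. Qed.

(* One jeu de taquin slide on row words: [p] is the row of the hole and [sigma]
   the shape traversed so far, without the hole. *)
Fixpoint glide (sigma : nat -> nat) (p : nat) (u : seq nat) : seq nat * nat :=
  if u is x :: u' then
    let c := (x == p.+1) && (sigma p.+1 == sigma p) in
    let y := if c then p else x in
    let r := glide (addc sigma y) (if c then p.+1 else p) u' in (y :: r.1, r.2)
  else ([::], p).

Lemma glide_cat sigma p u v :
  glide sigma p (u ++ v) =
  (let r := glide sigma p u in
   let r' := glide (addw sigma r.1) r.2 v in (r.1 ++ r'.1, r'.2)).
Proof.
elim: u sigma p => [|x u IH] sigma p /=.
  by rewrite addw_nil; case: glide.
by rewrite IH /= addw_cons.
Qed.

Lemma size_glide sigma p u : size (glide sigma p u).1 = size u.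
Proof. by elim: u sigma p => //= x u IH sigma p; rewrite IH. Qed.

Lemma glide_leq sigma p u t : nth 0 (glide sigma p u).1 t <= nth 0 u t.
Proof.
elim: u sigma p t => [|x u IH] sigma p [|t] //=.
by case: ifP => // /andP[/eqP->].
Qed.

Lemma glide_step b sigma p x : p < b -> x < b -> dominant b sigma ->
  dominant b (addc (addc sigma p) x) ->
  let c := (x == p.+1) && (sigma p.+1 == sigma p) in
  dominant b (addc sigma (if c then p else x)) /\ (if c then p.+1 else p) < b.
Proof.
move=> pb xb d d2 /=; case: andP => [[/eqP xp /eqP e]|h]; last first.
  split=> // q qb; have := d2 q qb; have := d q qb; rewrite /addc.
  case: (eqVneq x q.+1) => [xq|]; last by lia.
  case: (eqVneq x q) => [|_]; first by lia.
  case: (eqVneq p q) => [pq|]; last by lia.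
  suff : sigma q.+1 <> sigma q by lia.
  by move=> e; case: h; rewrite xq pq e.
subst x; split=> // q qb; have := d2 q qb; have := d q qb; rewrite /addc.
case: (eqVneq p q.+1) => [pq|]; last by lia.
by subst p; decide_eqs; lia.
Qed.

(** Hole and letter together occupy the same cells whether or not they exchange rows. *)
Lemma addc_glide sigma p x :
  let c := (x == p.+1) && (sigma p.+1 == sigma p) in
  addc (addc sigma (if c then p else x)) (if c then p.+1 else p) =
  addc (addc sigma p) x.
Proof. by move=> c; rewrite /c; case: andP => [[/eqP->]|_] //; rewrite addcC. Qed.

Lemma glide_lattice b sigma p u : p < b -> dominant b sigma ->
  lattice b (addc sigma p) u ->
  [/\ lattice b sigma (glide sigma p u).1, (glide sigma p u).2 < b &
      addc (addw sigma (glide sigma p u).1) (glide sigma p u).2 =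
      addw (addc sigma p) u].
Proof.
elim: u sigma p => [|x u IH] sigma p pb d /=; first by rewrite !addw_nil.
case=> d1 [xb lu]; rewrite !addw_cons.
have [d2 pb2] := glide_step pb xb d (lattice_dominant lu).
rewrite -addc_glide in lu; have [l2 pb3 e] := IH _ _ pb2 d2 lu.
split=> //; last by rewrite e addc_glide.
split=> //; split=> //; by case: ifP.
Qed.

(* When the hole drops a row, the letter that it changes is exactly the one that
   [raise] changes in the whole word, read from the inner shape [tau]. *)
Lemma hw_cat_glide b tau v sigma p u : p < b -> lattice b tau v ->
  sigma = addw tau v -> lattice b (addc sigma p) u ->
  hw b (v ++ (glide sigma p u).1) = hw b (v ++ u).
Proof.
elim: u v sigma p => [|x u IH] v sigma p // pb lv es [d1 [xb lu]].
have d : dominant b sigma by rewrite es; apply: lattice_end.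
have [d2 pb2] := glide_step pb xb d (lattice_dominant lu).
move: d2 pb2 (addc_glide sigma p x); rewrite /=; set c := andb _ _ => d2 pb2 e.
rewrite -cat_rcons IH //; first last.
- by rewrite e.
- by rewrite -cats1 addw_cat -es addw_cons addw_nil.
- rewrite -cats1; apply/lattice_cat; split=> //=; rewrite -es.
  by split=> //; split=> //; case: ifP.
rewrite cat_rcons {d2 pb2}; move: e; rewrite /c.
case: andP => [[/eqP xp /eqP e] es2|_ _] //; subst x.
(* Rows [p] and [p.+1] of [sigma] are equal, so no bracket is open after [v]: the raising changes
   the letter [p.+1] and then fixes [u]. *)
rewrite -(hw_raise (tau p - tau p.+1) (v ++ p.+1 :: u) xb) raise_cat.
have rv := raise_id xb lv.
have := rstate_count p (tau p - tau p.+1) v; rewrite rv => st.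
have dt := lattice_dominant lv xb; have := lattice_end lv.
have -> : rstate p (tau p - tau p.+1) v = 0.
  by move: e; rewrite es /addw; lia.
move=> _; congr (hw b (_ ++ _)); decide_eqs; congr (_ :: _).
have := raise_id xb lu; rewrite (_ : _ - _ = 0) //.
by rewrite /addc; decide_eqs; lia.
Qed.

Lemma hw_glide b sigma p u : p < b -> dominant b sigma ->
  lattice b (addc sigma p) u -> hw b (glide sigma p u).1 = hw b u.
Proof.
move=> pb d lu; apply: (@hw_cat_glide b sigma [::]) => //.
by rewrite addw_nil.
Qed.

(** * Rectification from an inner shape *)

Lemma filter_iota_last (P : pred nat) b :
  match [seq i <- iota 0 b | P i] with
  | [::] => forall q, q < b -> ~~ P q
  | i0 :: idx => let p := last i0 idx in
      [/\ p < b, P p & forall q, p < q -> q < b -> ~~ P q]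
  end.
Proof.
elim: b => [|b] //; rewrite -addn1 iotaD filter_cat /= add0n.
case: ifP => Pb; case: [seq i <- _ | _] => [|i0 idx] /=.
- by move=> h; split=> //; lia.
- rewrite last_cat /= => h; split=> //; lia.
- move=> h q; rewrite addn1 ltnS leq_eqVlt => /orP[/eqP->|/h //].
  by rewrite Pb.
rewrite cats0 => -[h1 h2 h3]; split=> //; first by lia.
move=> q pq; rewrite addn1 ltnS leq_eqVlt => /orP[/eqP->|]; last exact: h3.
by rewrite Pb.
Qed.

Definition decc (rho : nat -> nat) p : nat -> nat := fun q => rho q - (p == q).

Lemma decc_corner b mu p : p < b -> 0 < mu p ->
  (forall q, p < q -> q < b -> ~~ (0 < mu q)) -> dominant b mu ->
  dominant b (decc mu p) /\ addc (decc mu p) p = mu.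
Proof.
move=> pb mp mq d; split.
  move=> q qb; have := d q qb; rewrite /decc.
  case: (eqVneq p q) => [pq|]; last by lia.
  by subst q; have := mq p.+1 (ltnSn p) qb; lia.
apply: functional_extensionality => q; rewrite /addc /decc.
by case: eqP => [<-|]; lia.
Qed.

Lemma lattice_ext b rho rho' u : (forall p, p < b -> rho p = rho' p) ->
  lattice b rho u -> lattice b rho' u.
Proof.
elim: u rho rho' => [|x u IH] rho rho' e /= [d h].
  by split=> // p pb; rewrite -!e //; [apply: d | apply: ltnW].
split; first by move=> p pb; rewrite -!e //; [apply: d | apply: ltnW].
case: h => xb lu; split=> //; apply: IH lu => p pb.
by rewrite /addc e.
Qed.

Lemma rect_step b mu p u : p < b -> 0 < mu p ->
  (forall q, p < q -> q < b -> ~~ (0 < mu q)) -> lattice b mu u ->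
  let r := glide (decc mu p) p u in
  [/\ lattice b (decc mu p) r.1, r.2 < b, hw b r.1 = hw b u &
      addc (addw (decc mu p) r.1) r.2 = addw mu u].
Proof.
move=> pb mp mq lu /=.
have [d e] := decc_corner pb mp mq (lattice_dominant lu).
have lu' : lattice b (addc (decc mu p) p) u by rewrite e.
have [l1 l2 l3] := glide_lattice pb d lu'.
by split=> //; [apply: hw_glide | rewrite l3 e].
Qed.

Lemma sum_decc b mu p : p < b -> 0 < mu p ->
  (\sum_(q < b) decc mu p q).+1 = \sum_(q < b) mu q.
Proof.
move=> pb mp; rewrite (bigD1 (Ordinal pb)) //= [RHS](bigD1 (Ordinal pb)) //=.
rewrite -addSn; congr addn; first by rewrite /decc eqxx subn1 prednK.
apply: eq_bigr => q /eqP nq; rewrite /decc; case: eqP => [pq|]; last by rewrite subn0.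
by case: nq; apply: val_inj.
Qed.

(* Rectifying from the inner shape [mu] only shrinks the outer shape. *)
Lemma hw_lattice_skew b mu u : lattice b mu u ->
  lattice b (fun=> 0) (hw b u) /\ forall q, q < b -> ct (hw b u) q <= mu q + ct u q.
Proof.
move en : (\sum_(p < b) mu p) => n; elim: n mu u en => [|n IH] mu u en lu.
  have l0 : lattice b (fun=> 0) u.
    apply: lattice_ext lu => p pb; apply/eqP; rewrite -leqn0 -en.
    by rewrite (bigD1 (Ordinal pb)) //= leq_addr.
  by rewrite hw_id //; split=> // q _; rewrite leq_addl.
have := filter_iota_last (fun i => 0 < mu i) b.
case: filter => [|i0 idx] /=.
  move=> h; have : n.+1 = 0 by rewrite -en big1 // => q _; have := h q (ltn_ord q); lia.
  by [].
move: (last i0 idx) => p [pb mp mq].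
have [l1 l2 l3 l4] := rect_step pb mp mq lu; rewrite -l3.
have := sum_decc pb mp; rewrite en => -[] en'.
have [h1 h2] := IH _ _ en' l1; split=> // q qb.
apply: leq_trans (h2 q qb) _.
by move/(congr1 (fun f => f q)): l4; rewrite /addc /addw => <-; rewrite leq_addr.
Qed.

Lemma hw_lattice b u : all (gtn b) u -> lattice b (fun=> 0) (hw b u).
Proof.
move=> ub; apply: (proj1 (@hw_lattice_skew b (fun p => (b - p) * size u) u _)).
apply: latticeP => // n p pb; rewrite /addw.
have h : ct (take n u) p.+1 <= size u.
  by apply: leq_trans (count_size _ _) _; rewrite size_take_min geq_minr.
have -> : b - p = (b - p.+1).+1 by lia.
by rewrite mulSn; lia.
Qed.

Lemma hw_cat_prefix b u v : exists2 w, size w = size v & hw b (u ++ v) = hw b u ++ w.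
Proof.
exists (drop (size u) (hw b (u ++ v))).
  by rewrite size_drop size_hw size_cat addKn.
have <- : take (size u) (hw b (u ++ v)) = hw b u by rewrite take_hw take_size_cat.
by rewrite cat_take_drop.
Qed.

(** * Rotation *)

(* Rotation by 180 degrees and reversal of the entries, on row words. *)
Definition star b (u : seq nat) := map (fun x => b.-1 - x) (rev u).

Lemma star_cat b u v : star b (u ++ v) = star b v ++ star b u.
Proof. by rewrite /star rev_cat map_cat. Qed.

Lemma star_cons b x u : star b (x :: u) = star b u ++ [:: b.-1 - x].
Proof. by rewrite -cat1s star_cat. Qed.

Lemma size_star b u : size (star b u) = size u.
Proof. by rewrite size_map size_rev. Qed.

Lemma all_star b u : all (gtn b) u -> all (gtn b) (star b u).
Proof.
elim: u => //= x u IH /andP[xb ub]; rewrite star_cons all_cat IH //= andbT; lia.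
Qed.

Lemma starK b u : all (gtn b) u -> star b (star b u) = u.
Proof.
elim: u => //= x u IH /andP[xb ub]; rewrite star_cons star_cat IH //.
by rewrite /star /=; congr cons; lia.
Qed.

Lemma ct_star b u q : q < b -> all (gtn b) u -> ct (star b u) q = ct u (b.-1 - q).
Proof.
move=> qb; elim: u => //= x u IH /andP[xb ub].
by rewrite star_cons ct_cat IH // !ct_cons addnC /= addn0; congr addn; lia.
Qed.

Lemma star_pow b N w : star b (pow N w) = pow N (star b w).
Proof. by elim: N => // N IH; rewrite powS star_cat IH -powSr. Qed.

Lemma rstate_cat i c u v : rstate i c (u ++ v) = rstate i (rstate i c u) v.
Proof. by elim: u c => //= x u IH c; case: ifP => _ //; case: ifP. Qed.

Lemma unmatched_raise i c u : unmatched i (raise i c u) = minn c (unmatched i u).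
Proof.
elim: u c => [|x u IH] c; first by rewrite minn0.
case: (eqVneq x i) => [->|n0]; first by (decide_eqs; rewrite IH; lia).
case: (eqVneq x i.+1) => [->|n1]; last by decide_eqs.
by case: c => [|c]; decide_eqs; rewrite IH; lia.
Qed.

(** Rotation sends [i] to the closing and [i.+1] to the opening letter of index [b.-2 - i], so
    unmatched closings become unmatched openings. *)
Lemma rstate_star b i u : i.+1 < b -> all (gtn b) u ->
  rstate (b.-2 - i) 0 (star b u) = unmatched i u.
Proof.
move=> ib; elim: u => //= x u IH /andP[xb ub].
rewrite star_cons rstate_cat IH //.
case: (eqVneq x i) => [->|n0]; first by decide_eqs.
by case: (eqVneq x i.+1) => [->|n1]; decide_eqs.
Qed.

(** Raising [u] moves its rotation along the string of index [b.-2 - i], and full raising forgets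
    the position on a string. *)
Lemma raise_star b i c u : i.+1 < b -> all (gtn b) u ->
  raise (b.-2 - i) 0 (star b (raise i c u)) = raise (b.-2 - i) 0 (star b u).
Proof.
move=> ib; elim: u c => [|x u IH] c //= /andP[xb ub].
case: (eqVneq x i) => [->|n0].
  rewrite !star_cons !raise_cat IH // !rstate_star ?all_raise //.
  rewrite unmatched_raise; congr cat.
  by case: (unmatched i u) => [|e]; rewrite ?minn0 ?minnSS; decide_eqs.
case: (eqVneq x i.+1) => [->|n1].
  case: c => [|c]; rewrite !star_cons !raise_cat IH // !rstate_star ?all_raise //.
    by rewrite unmatched_raise min0n; congr cat; decide_eqs; congr cons; lia.
  by congr cat; decide_eqs.
rewrite !star_cons !raise_cat IH // !rstate_star ?all_raise //.
by congr cat; decide_eqs.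
Qed.

Lemma hw_star_raise b i c u : i.+1 < b -> all (gtn b) u ->
  hw b (star b (raise i c u)) = hw b (star b u).
Proof.
move=> ib ub; have ib' : (b.-2 - i).+1 < b by lia.
by rewrite -(hw_raise 0 _ ib') raise_star // hw_raise.
Qed.

Lemma hw_star_hw b u : all (gtn b) u -> hw b (star b (hw b u)) = hw b (star b u).
Proof.
move=> ub; rewrite {2}/hw; elim: (longest b.-1) (longest_lt b.-1) => //= i s IH.
by case/andP=> ib /IH<-; rewrite hw_star_raise ?all_raises //; lia.
Qed.

(** * Rotation preserves the shape of the rectification *)

Lemma sumn_raise i c u : sumn (raise i c u) + (unmatched i u - c) = sumn u.
Proof.
elim: u c => [|x u IH] c //.
case: (eqVneq x i) => [->|n0]; first by (decide_eqs; have := IH c.+1; lia).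
case: (eqVneq x i.+1) => [->|n1].
  case: c => [|c]; decide_eqs; first by (have := IH 0; lia).
  by have := IH c; lia.
by decide_eqs; have := IH c; lia.
Qed.

Lemma perm_swap (f g : nat -> nat) b p : p.+1 < b ->
  f p = g p.+1 -> f p.+1 = g p -> (forall q, q != p -> q != p.+1 -> f q = g q) ->
  perm_eq (map f (iota 0 b)) (map g (iota 0 b)).
Proof.
move=> pb e1 e2 e3.
have -> : iota 0 b = iota 0 p ++ [:: p; p.+1] ++ iota p.+2 (b - p.+2).
  have {1}-> : b = p + 2 + (b - p.+2) by lia.
  by rewrite !iotaD -catA add0n addn2.
rewrite !map_cat; have -> : map f (iota 0 p) = map g (iota 0 p).
  by apply/eq_in_map => q; rewrite mem_iota => ?; apply: e3; lia.
have -> : map f (iota p.+2 (b - p.+2)) = map g (iota p.+2 (b - p.+2)).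
  by apply/eq_in_map => q; rewrite mem_iota => ?; apply: e3; lia.
rewrite perm_cat2l perm_cat2r /= e1 e2.
by rewrite -[X in perm_eq X]/([:: g p.+1] ++ [:: g p]) perm_catC.
Qed.

(* Bubble sort by crystal reflections. *)
Lemma sort_content b u : all (gtn b) u -> exists z,
  [/\ all (gtn b) z, hw b z = hw b u, dominant b (ct z) &
      perm_eq (map (ct z) (iota 0 b)) (map (ct u) (iota 0 b))].
Proof.
move en : (sumn u) => n; elim/ltn_ind: n u en => n IH u en ub.
case: (boolP [exists p : 'I_b, (p.+1 < b) && (ct u p < ct u p.+1)]); last first.
  move=> /existsPn h; exists u; split=> // p pb.
  by have := h (Ordinal (ltnW pb)); rewrite /= pb -leqNgt.
case/existsP=> -[p ?] /= /andP[pb lt].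
(* With this counter exactly [ct u p.+1 - ct u p] letters change, which exchanges the two contents
   and lowers the sum of the letters. *)
pose c := unmatched p u - (ct u p.+1 - ct u p).
have ug := unmatched_ge p u.
have [z [zb hz dz pz]] : exists z,
  [/\ all (gtn b) z, hw b z = hw b (raise p c u), dominant b (ct z) &
      perm_eq (map (ct z) (iota 0 b)) (map (ct (raise p c u)) (iota 0 b))].
  apply: (IH _ _ _ erefl); last exact: all_raise.
  by rewrite -en -(sumn_raise p c u) /c; lia.
exists z; split=> //; first by rewrite hz hw_raise.
apply: perm_trans pz _; apply: (perm_swap pb).
- by rewrite ct_raise /c; lia.
- by have := ct_raiseS p c u; rewrite /c; lia.
by move=> q q0 q1; rewrite ct_raise_other.
Qed.

Lemma count_gtnS j u : count (gtn j.+1) u = count (gtn j) u + ct u j.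
Proof. by elim: u => [|x u IH] //; rewrite ct_cons /= IH; lia. Qed.

Lemma count_gtn_raise j i c u : count (gtn j) u <= count (gtn j) (raise i c u).
Proof.
elim: u c => [|x u IH] c //.
case: (eqVneq x i) => [->|n0]; first by (decide_eqs; have := IH c.+1; lia).
case: (eqVneq x i.+1) => [->|n1].
  case: c => [|c]; decide_eqs; first by (have := IH 0; lia).
  by have := IH c; lia.
by decide_eqs; have := IH c; lia.
Qed.

Lemma count_gtn_hw b j u : count (gtn j) u <= count (gtn j) (hw b u).
Proof.
rewrite /hw; elim: (longest _) => //= i s IH.
by apply: leq_trans IH _; apply: count_gtn_raise.
Qed.

Lemma eq_dominant b f g : dominant b f -> dominant b g ->
  perm_eq (map f (iota 0 b)) (map g (iota 0 b)) -> forall q, q < b -> f q = g q.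
Proof.
have sorted_dom h : dominant b h -> sorted geq (map h (iota 0 b)).
  move=> d; apply/(sortedP 0) => i; rewrite size_map size_iota => ib.
  by rewrite !(nth_map 0) ?size_iota ?nth_iota ?(ltnW ib) //; apply: d.
move=> df dg fg q qb.
have e : map f (iota 0 b) = map g (iota 0 b).
  apply: (sorted_eq (leT := geq)); rewrite ?sorted_dom //.
    by move=> x y z /=; lia.
  by move=> x y /=; lia.
by have := congr1 (nth 0 ^~ q) e; rewrite !(nth_map 0) ?size_iota ?nth_iota.
Qed.

Lemma lattice_ct b u : lattice b (fun=> 0) u -> dominant b (ct u).
Proof. exact: lattice_end. Qed.

(** Sorting the rotation of [v] yields a word [z] with the content of [v] and with
    [hw b z = hw b u]; raising [z] cannot decrease the number of letters below [j]. Used for [u] and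
    for its rotation, this gives equal shapes. *)
Lemma count_gtn_hw_star b u j : all (gtn b) u -> j <= b ->
  count (gtn j) (hw b (star b u)) <= count (gtn j) (hw b u).
Proof.
move=> ub jb; set v := hw b (star b u).
have vb : all (gtn b) v by rewrite all_hw ?all_star.
have [z [zb hz dz pz]] := sort_content (all_star vb).
have hv : hw b z = hw b u by rewrite hz hw_star_hw ?starK ?all_star.
have e q : q < b -> ct z q = ct v q.
  apply: eq_dominant => //; first by apply/lattice_ct/hw_lattice/all_star.
  apply: perm_trans pz _; rewrite perm_sym -perm_rev -map_rev.
  apply/permP => a; congr count; apply: (@eq_from_nth _ 0).
    by rewrite !size_map size_rev.
  move=> i; rewrite size_map size_rev size_iota => ib.
  rewrite !(nth_map 0) ?size_rev ?size_iota ?nth_rev ?size_iota ?nth_iota //; last by lia.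
  by rewrite ct_star //; congr ct; lia.
rewrite -hv; apply: leq_trans (count_gtn_hw _ _ _).
elim: j jb => [|j IH] jb; first by elim: (v) => //= x s; lia.
by rewrite !count_gtnS e // leq_add2r IH // ltnW.
Qed.

Lemma ct_hw_star b u q : all (gtn b) u -> q < b ->
  ct (hw b (star b u)) q = ct (hw b u) q.
Proof.
move=> ub qb.
have e j : j <= b -> count (gtn j) (hw b (star b u)) = count (gtn j) (hw b u).
  move=> jb; apply/eqP; rewrite eqn_leq count_gtn_hw_star //=.
  by rewrite -{1}(starK ub) count_gtn_hw_star ?all_star.
by have := e _ qb; rewrite !count_gtnS e ?(ltnW qb) //; lia.
Qed.

(** * Promotion *)

(** Seen backwards in the rotated rectangle, a slide is a slide along the same path. [tau] is the
    rotated complement of the outer shape, hole included. *)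
Lemma glide_star b M sigma tau p t : p < b -> dominant b sigma ->
  lattice b (addc sigma p) t ->
  (forall q, q < b -> tau q + addw (addc sigma p) t (b.-1 - q) = M) ->
  let r := glide sigma p t in
  glide tau (b.-1 - r.2) (star b r.1) = (star b t, b.-1 - p).
Proof.
elim: t sigma p => [|x t IH] sigma p pb d //= [d1 [xb lt]] compl.
have [d2 pb2] := glide_step pb xb d (lattice_dominant lt).
have := addc_glide sigma p x; move: d2 pb2.
rewrite /=; set c := andb _ _; set y := if c then p else x.
set p1 := if c then _ else _ => d2 pb2 e.
rewrite -e in lt; rewrite !star_cons glide_cat IH //; last first.
  by move=> q qb; rewrite e -addw_cons compl.
rewrite /= ; set tau' := addw tau _.
have t'E q : q < b -> tau' q + addc (addc sigma p) x (b.-1 - q) = M.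
  move=> qb; rewrite -(compl q qb) addw_cons /tau' /addw ct_star //.
    by rewrite -addnA; congr addn; rewrite addnC.
  exact: lattice_lt lt.
have tE1 := t'E (b.-1 - p); have tE2 := t'E (b.-1 - p.+1).
have tE3 := t'E (b.-1 - x).
rewrite /y /p1; case: (boolP c) => ct0.
  move: ct0; rewrite /c => /andP[/eqP xp /eqP sp]; subst x.
  have e1 : b.-1 - p = (b.-1 - p.+1).+1 by lia.
  rewrite -e1 eqxx /= (_ : _ == _) //.
  by move: tE1 tE2; rewrite !subKn /addc; lia.
(* If only the rotated slide changed row, rows [x] and [x.+1] would be equal with hole and letter
   added, but row [x] is then strictly longer. *)
rewrite (_ : andb _ _ = false) //; apply/negbTE/andP => -[/eqP xp /eqP tt].
have xp' : p = x.+1 by lia.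
subst p; move: tE1 tE3; rewrite !subKn /addc; try lia.
have := d1 x pb; rewrite /addc; decide_eqs.
have -> : b.-1 - x = (b.-1 - x.+1).+1 by lia.
by rewrite tt; lia.
Qed.

(* Lowest weight words: they encode [RectStar]. *)
Definition lw b u := star b (hw b (star b u)).

(** In a lattice word the first letter is 0, so its removal opens a hole in row 0; the row where the
    hole ends receives the new largest entry. *)
Definition promote (u : seq nat) :=
  let r := glide (fun=> 0) 0 (behead u) in rcons r.1 r.2.

Lemma lattice0_cons b x u : lattice b (fun=> 0) (x :: u) -> x = 0.
Proof.
case: x => [|x] //= [_ [xb lu]].
by have := lattice_dominant lu xb; rewrite /addc; decide_eqs.
Qed.

(** Erasing the first letter of [hw b (x :: u)] and sliding gives a lattice word; neither operation
    changes what [hw] makes of the remaining letters, so this word is [hw b u]. *)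
Lemma glide_hw_cons b x u : x < b -> all (gtn b) u ->
  exists t p, [/\ hw b (x :: u) = 0 :: t, p < b,
    glide (fun=> 0) 0 t = (hw b u, p), lattice b (addc (fun=> 0) 0) t &
    forall q, ct (hw b (x :: u)) q = ct (hw b u) q + (p == q)].
Proof.
move=> xb ub; have b0 : 0 < b by lia.
have l0 : lattice b (fun=> 0) (hw b (x :: u)) by apply: hw_lattice; rewrite /= xb.
have := hw_behead b (x :: u); rewrite [behead (x :: u)]/=.
have := size_hw b (x :: u).
case E: (hw b (x :: u)) l0 => [|x0 t] // l0 _; rewrite [behead _]/= => ht.
have x00 := lattice0_cons l0; subst x0.
case: l0 => d0 [_ l0].
have [l1 l2 l3] := glide_lattice b0 d0 l0.
have ho : (glide (fun=> 0) 0 t).1 = hw b u by rewrite -(hw_id l1) (hw_glide b0 d0 l0).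
exists t, (glide (fun=> 0) 0 t).2; split=> //.
  by rewrite -ho; case: glide.
move=> q; move/(congr1 (fun f => f q)): l3.
by rewrite ho /addc /addw ct_cons !add0n.
Qed.

(** The slide turns [hw b (x :: u)] into [hw b u], then crosses [lw b v] as the reversal of the
    slide that deletes the first letter of the rotation of [rcons v x]. *)
Lemma promote_split b x u v M : x < b -> all (gtn b) u -> all (gtn b) v ->
  (forall q, q < b -> ct (hw b (x :: u)) q + ct (hw b v) (b.-1 - q) = M) ->
  (forall q, q < b -> ct (hw b u) q + ct (hw b (rcons v x)) (b.-1 - q) = M) ->
  promote (hw b (x :: u) ++ lw b v) = hw b u ++ lw b (rcons v x).
Proof.
move=> xb ub vb h1 h2; have b0 : 0 < b by lia.
have [t [p [Et pb gt lt ep]]] := glide_hw_cons xb ub.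
have xb' : b.-1 - x < b by lia.
have [t' [p' [Et' pb' gt' lt' ep']]] := glide_hw_cons xb' (all_star vb).
have vxb : all (gtn b) (rcons v x) by rewrite all_rcons /= xb.
have ev : star b (rcons v x) = (b.-1 - x) :: star b v by rewrite -cats1 star_cat.
(* By complementarity the cell lost by the left factor is the one gained by the right factor, so the
   two slides meet. *)
have pp : p = b.-1 - p'.
  have := h1 p pb; have := h2 p pb; rewrite ep eqxx.
  rewrite -(ct_hw_star vb) -?(ct_hw_star vxb) ?ev ?ep'; lia.
rewrite /promote Et /= glide_cat gt /= pp.
have := @glide_star b M (fun=> 0) (addw (fun=> 0) (hw b u)) 0 t' b0 _ lt'.
rewrite gt' /= => ->.
- by rewrite /lw ev Et' star_cons subn0 rcons_cat cats1.
- by move=> q.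
move=> q qb; rewrite -(h2 q qb) -(ct_hw_star vxb); last by lia.
by rewrite ev Et' -addw_cons /addw !add0n.
Qed.

(** The rotated word traverses the rotated complements of the shapes traversed by [s], in reverse
    order. *)
Lemma lattice_star b M sigma tau s : lattice b sigma s ->
  (forall q, q < b -> tau q + addw sigma s (b.-1 - q) = M) ->
  lattice b tau (star b s).
Proof.
have dom_compl rho rho' : dominant b rho ->
    (forall q, q < b -> rho' q + rho (b.-1 - q) = M) -> dominant b rho'.
  move=> d e p pb; have := e _ pb; have := e _ (ltnW pb).
  have /d : (b.-1 - p.+1).+1 < b by lia.
  have -> : (b.-1 - p.+1).+1 = b.-1 - p by lia.
  lia.
elim: s sigma => [|x s IH] sigma; first by rewrite addw_nil => -[d _] /(dom_compl _ _ d).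
case=> d [xb ls] e; rewrite star_cons; apply/lattice_cat; split.
  by apply: IH ls _ => q qb; rewrite -(e q qb) addw_cons.
have ts q : q < b -> addw tau (star b s) q + addc sigma x (b.-1 - q) = M.
  move=> qb; rewrite -(e q qb) addw_cons /addw ct_star ?(lattice_lt ls) //; lia.
split; first exact: dom_compl (lattice_dominant ls) ts.
split; first by lia.
split=> //; apply: dom_compl d _ => q qb; have := ts q qb; rewrite /addc; lia.
Qed.

Lemma lattice_shift b rho rho' c u : lattice b rho u ->
  (forall q, q < b -> rho' q = rho q + c) -> lattice b rho' u.
Proof.
elim: u rho rho' => [|x u IH] rho rho' /= [d h] e.
  by split=> // p pb; rewrite !e ?leq_add2r ?(ltnW pb) //; apply: d.
case: h => xb h; split; first by move=> p pb; rewrite !e ?leq_add2r ?(ltnW pb) //; apply: d.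
by split=> //; apply: IH h _ => q qb; rewrite /addc e // addnAC.
Qed.

Lemma lattice_pow b r rho w N : (forall q, q < b -> ct w q = r) ->
  lattice b rho w -> lattice b rho (pow N w).
Proof.
move=> bal; elim: N rho => [|N IH] rho lw; first by split=> //; apply: lattice_dominant lw.
rewrite powS; apply/lattice_cat; split=> //; apply: IH; apply: lattice_shift lw _.
by move=> q qb; rewrite /addw bal.
Qed.

(** With [unmatched_attained], this identifies [unmatched p w] as the maximal excess of [p.+1] over
    [p] among the prefixes of [w]. *)
Lemma unmatched_take p w j : ct (take j w) p.+1 <= unmatched p w + ct (take j w) p.
Proof.
elim: w j => [|x w IH] [|j] //.
have := IH j; case: (eqVneq x p) => [->|n0]; first by (decide_eqs; lia).
by case: (eqVneq x p.+1) => [->|n1]; decide_eqs; lia.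
Qed.

Lemma unmatched_attained p w : exists j,
  ct (take j w) p.+1 = unmatched p w + ct (take j w) p.
Proof.
elim: w => [|x w [j IH]]; first by exists 0.
case: (eqVneq x p) => [->|n0].
  case E: (unmatched p w) => [|e]; first by exists 0; decide_eqs; rewrite E.
  by exists j.+1; decide_eqs; rewrite E in IH *; lia.
case: (eqVneq x p.+1) => [->|n1]; exists j.+1; decide_eqs; lia.
Qed.

Lemma sum_ct b u : all (gtn b) u -> \sum_(q < b) ct u q = size u.
Proof.
move=> ub; rewrite -(eqP (etrans (esym (all_count _ _)) ub)).
elim: b {ub} => [|b IH]; first by rewrite big_ord0; elim: u.
by rewrite big_ord_recr /= IH count_gtnS.
Qed.

Lemma leq_sum_eq b (f g : nat -> nat) : (forall q, q < b -> f q <= g q) ->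
  \sum_(q < b) f q = \sum_(q < b) g q -> forall q, q < b -> f q = g q.
Proof.
move=> le e q qb.
have [_] := leqif_sum (P := predT) (fun (i : 'I_b) _ => leqif_eq (le i (ltn_ord i))).
by rewrite e eqxx => /esym/forallP/(_ (Ordinal qb))/eqP.
Qed.

Lemma leq_sumn_eq (u v : seq nat) : size u = size v ->
  (forall t, nth 0 u t <= nth 0 v t) -> sumn u = sumn v -> u = v.
Proof.
move=> sz le; have main : sumn u <= sumn v /\ (sumn u = sumn v -> u = v).
  elim: u v sz le => [|x u IH] [|y v] //= [sz] le.
  have [h1 h2] := IH v sz (fun t => le t.+1); have := le 0 => /= xy.
  by split=> [|e]; [lia | rewrite h2; [congr cons; lia | lia]].
by case: main.
Qed.

(** Deleting a first letter is a slide, and slides never increase a letter. *)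
Lemma hw_drop_leq b n u t : all (gtn b) u ->
  nth 0 (hw b (drop n u)) t <= nth 0 (hw b u) (n + t).
Proof.
elim: n u => [|n IH] u ub; first by rewrite drop0.
case: u ub => [_|x u /andP[xb ub]]; first by rewrite nth_default // size_hw.
rewrite [drop _ _]/=.
apply: leq_trans (IH u ub) _.
have [t' [p [-> _ gt _ _]]] := glide_hw_cons xb ub.
by have := glide_leq (fun=> 0) 0 t' (n + t); rewrite gt addSn.
Qed.

(** * Stable words *)

Section Stable.
Variables (b r K : nat) (w : seq nat).
Hypothesis wb : all (gtn b) w.
Hypothesis bal : forall q, q < b -> ct w q = r.
Hypothesis stab : hw b (pow K w ++ w) = hw b (pow K w) ++ w.

Local Notation lam := (ct (hw b (pow K w))).

Lemma hw_pow_stable N : hw b (pow K w ++ pow N w) = hw b (pow K w) ++ pow N w.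
Proof.
apply: raises_stable stab => i /(allP (longest_lt _)) /= ib.
by rewrite !bal //; lia.
Qed.

Lemma hw_pow_take_stable N j :
  hw b (pow K w ++ pow N w ++ take j w) = hw b (pow K w) ++ pow N w ++ take j w.
Proof.
have pw : take (size (pow K w ++ pow N w) + j) (pow K w ++ pow N.+1 w) =
    pow K w ++ pow N w ++ take j w.
  by rewrite powSr catA takeD take_size_cat // drop_size_cat // catA.
rewrite -pw -take_hw hw_pow_stable powSr catA takeD.
have sz : size (hw b (pow K w) ++ pow N w) = size (pow K w ++ pow N w).
  by rewrite !size_cat size_hw.
by rewrite -sz take_size_cat // drop_size_cat // catA.
Qed.

Lemma star_bal q : q < b -> ct (star b w) q = r.
Proof. by move=> qb; rewrite ct_star ?bal //; lia. Qed.

Lemma ct_hw_pow_star N q : q < b ->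
  ct (hw b (pow N (star b w))) q = ct (hw b (pow N w)) q.
Proof. by move=> qb; rewrite -star_pow ct_hw_star ?all_pow. Qed.

(* Rectification only decreases letters, and the shapes of [w] and [star b w] have
   the same increments, so the last block has the content of [star b w]. *)
Lemma stab_star :
  hw b (pow K (star b w) ++ star b w) = hw b (pow K (star b w)) ++ star b w.
Proof.
have [z sz e] := hw_cat_prefix b (pow K (star b w)) (star b w).
rewrite e; congr cat; have sb := all_star wb.
have ab : all (gtn b) (hw b (pow K (star b w)) ++ z).
  by rewrite -e; apply: all_hw; rewrite all_cat all_pow.
apply: leq_sumn_eq => // [t|].
  have := raises_leq (longest b.-1) (pow K (star b w) ++ star b w)
            (size (pow K (star b w)) + t).
  rewrite -/(hw b _) e !nth_cat size_hw ltnNge leq_addr /= addKn //.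
apply: perm_sumn; apply/allP => q _ /=; apply/eqP; rewrite -/(ct z q) -/(ct _ q).
case: (ltnP q b) => qb; last first.
  have out u : all (gtn b) u -> ct u q = 0.
    elim: u => // x u IH /andP[xb /IH]; rewrite ct_cons => ->.
    by move: xb => /= xb; decide_eqs.
  by rewrite !out //; move: ab; rewrite all_cat => /andP[].
rewrite star_bal //; move: (congr1 (ct^~ q) e).
by rewrite -powSr ct_cat !ct_hw_pow_star // powSr stab ct_cat bal //; lia.
Qed.

Lemma take_star i : star b (drop i w) = take (size w - i) (star b w).
Proof.
rewrite /star -map_take take_rev; congr (map _ (rev _)).
case: (leqP i (size w)) => iw; first by rewrite subKn.
by rewrite (eqP (ltnW iw)) subn0 drop_size drop_oversize // ltnW.
Qed.

(** After rotation the suffix of [w] becomes a prefix of [star b w] following [K] full copies, where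
    [stab_star] applies. *)
Lemma ct_hw_drop_pow i q : q < b ->
  ct (hw b (drop i w ++ pow K w)) q = lam q + ct (drop i w) (b.-1 - q).
Proof.
move=> qb; have db : all (gtn b) (drop i w).
  by apply/allP => x /mem_drop /(allP wb).
rewrite -ct_hw_star // ?all_cat ?db ?all_pow // star_cat star_pow take_star.
have -> : pow K (star b w) ++ take (size w - i) (star b w) =
    take (size (pow K (star b w)) + (size w - i)) (pow K (star b w) ++ star b w).
  by rewrite takeD take_size_cat // drop_size_cat.
rewrite -take_hw stab_star -(size_hw b) takeD take_size_cat // drop_size_cat //.
by rewrite ct_cat ct_hw_pow_star // -take_star ct_star.
Qed.

(** [hw_drop_leq] squeezes the trailing letters: deleting [drop i w] bounds them below, completing
    it to [w] bounds them above, and stabilization fixes them in both comparison words. *)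
Lemma hw_drop_pow_take i j : i <= size w ->
  hw b (drop i w ++ pow K w ++ take j w) = hw b (drop i w ++ pow K w) ++ take j w.
Proof.
move=> iw; have jb : all (gtn b) (take j w) by apply/allP => x /mem_take /(allP wb).
have [z sz e] := hw_cat_prefix b (drop i w ++ pow K w) (take j w).
rewrite catA e; congr cat; apply: (@eq_from_nth _ 0) => // t _.
have zt n : n = size (drop i w ++ pow K w) + t ->
    nth 0 z t = nth 0 (hw b (drop i w ++ pow K w ++ take j w)) n.
  move=> ->; rewrite catA e nth_cat size_hw ltnNge leq_addr /= addKn //.
have wt n : n = size (pow K w) + t ->
    nth 0 (hw b (pow K w ++ take j w)) n = nth 0 (take j w) t.
  move=> ->; rewrite (hw_pow_take_stable 0) nth_cat size_hw ltnNge leq_addr /= addKn //.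
apply/eqP; rewrite eqn_leq; apply/andP; split.
  rewrite (zt _ erefl) size_cat.
  have -> : drop i w ++ pow K w ++ take j w = drop i (w ++ pow K w ++ take j w).
    rewrite drop_cat; case: ltnP => // le.
    by rewrite (_ : i = size w) ?subnn ?drop_size ?drop0 //; lia.
  apply: leq_trans (hw_drop_leq _ _ _) _.
    by rewrite !all_cat wb jb all_pow.
  have -> : w ++ pow K w ++ take j w = pow K w ++ w ++ take j w.
    by rewrite catA -powS powSr catA.
  have := hw_pow_take_stable 1 j; rewrite pow1 => ->.
  rewrite !nth_cat size_hw size_drop size_pow.
  do 2![case: ltnP => ?; first by lia].
  by rewrite leq_eqVlt; apply/orP; left; apply/eqP; congr nth; lia.
rewrite (zt _ erefl) -(wt _ erefl) size_cat -addnA.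
have := @hw_drop_leq b (size (drop i w)) (drop i w ++ pow K w ++ take j w)
          (size (pow K w) + t).
rewrite drop_size_cat //; apply; rewrite !all_cat jb all_pow // !andbT.
by apply/allP => x /mem_drop /(allP wb).
Qed.

(* The least inner shape from which [w] is a lattice word. *)
Definition min_inner p := \sum_(p <= q < b.-1) unmatched q w.

Lemma min_innerS p : p.+1 < b -> min_inner p = unmatched p w + min_inner p.+1.
Proof. by move=> pb; rewrite /min_inner big_ltn //; lia. Qed.

Lemma lattice_min_inner N : lattice b min_inner (pow N w).
Proof.
apply: lattice_pow bal _; apply: latticeP => // n p pb.
by have := unmatched_take p w n; rewrite /addw (min_innerS pb); lia.
Qed.

(* Far from the diagonal the growth diagram of the periodic word is affine in each
   direction, and two independent positions can be chosen to be extremal. *)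
Lemma lam_drop p : p.+1 < b ->
  lam p.+1 + unmatched (b.-2 - p) w + unmatched p w <= lam p.
Proof.
move=> pb; have [j ej] := unmatched_attained p w.
have [i0 ei0] := unmatched_attained (b.-2 - p) w.
(* The position [i0] may exceed [size w]; truncating it leaves the prefix unchanged. *)
pose i := minn i0 (size w); have iw : i <= size w by rewrite geq_minr.
have ei : ct (take i w) (b.-2 - p).+1 =
    unmatched (b.-2 - p) w + ct (take i w) (b.-2 - p).
  suff -> : take i w = take i0 w by [].
  by rewrite /i; case: (leqP i0 (size w)) => // h; rewrite take_size take_oversize // ltnW.
have db : all (gtn b) (drop i w ++ pow K w ++ take j w).
  rewrite !all_cat all_pow //=; apply/andP.
  by split; apply/allP => x; [move/mem_drop | move/mem_take]; move/(allP wb).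
(* The shape of this word is [lam] plus a term in [i] and a term in [j]; its being a partition is
   the claim. *)
have := lattice_ct (hw_lattice db) pb; rewrite hw_drop_pow_take // !ct_cat.
rewrite !ct_hw_drop_pow //; last by lia.
have h q : ct w q = ct (take i w) q + ct (drop i w) q by rewrite -ct_cat cat_take_drop.
have := h (b.-2 - p); have := h (b.-2 - p).+1.
rewrite !bal; try lia.
have -> : b.-1 - p.+1 = b.-2 - p by lia.
have -> : b.-1 - p = (b.-2 - p).+1 by lia.
by move: ej ei; lia.
Qed.

Lemma lam_dual q : q < b -> lam q + lam (b.-1 - q) = (2 * K) * r.
Proof.
(* Row 0 is bounded by rectifying from [min_inner]; [lam_drop] carries the bound down the rows. *)
have le p : p < b -> lam p + min_inner (b.-1 - p) <= K * r + min_inner p.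
  elim: p => [|p IH] pb.
    have [_ /(_ 0 pb)] := hw_lattice_skew (lattice_min_inner K).
    rewrite ct_pow bal // => h; rewrite subn0 {1}/min_inner big_geq //.
    by rewrite addn0 addnC.
  have := IH (ltnW pb); have := lam_drop pb; rewrite (min_innerS pb).
  have -> : b.-1 - p = (b.-1 - p.+1).+1 by lia.
  have := @min_innerS (b.-1 - p.+1).
  have -> : b.-1 - p.+1 = b.-2 - p by lia.
  by move=> ->; lia.
(* Summed over the rows, both sides of [le] agree, the [min_inner] terms being reversed; hence
   equality in each row. *)
have sl : \sum_(p < b) lam p = \sum_(p < b) (K * r).
  rewrite sum_ct ?all_hw ?all_pow // size_hw size_pow -(sum_ct wb).
  by rewrite big_distrr /=; apply: eq_bigr => p _; rewrite bal.
have eqs := leq_sum_eq le.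
have e p : p < b -> lam p + min_inner (b.-1 - p) = K * r + min_inner p.
  apply: eqs; rewrite !big_split /= sl; congr addn.
  rewrite (reindex_inj rev_ord_inj) /=; apply: eq_bigr => i _.
  by congr min_inner; have := ltn_ord i; lia.
move=> qb; have qb' : b.-1 - q < b by lia.
by have := e _ qb; have := e _ qb'; rewrite subKn -?mulnA; lia.
Qed.

Lemma lw_pow_stable N : lw b (pow (K + N) w) = pow N w ++ lw b (pow K w).
Proof.
rewrite /lw !star_pow powD /hw raises_stable; first 2 last.
- exact: stab_star.
- by rewrite star_cat star_pow starK.
move=> i /(allP (longest_lt _)) /= ib; rewrite !star_bal //; lia.
Qed.

(** * The promotion orbit of the word *)

Section Rotation.
Variable A : nat.
Hypothesis KA : K <= A.

(** The word after [i] promotions: the first [i] letters of [w] have moved from the left factor to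
    the right one. *)
Definition rot_word i := hw b (drop i w ++ pow K w) ++ lw b (pow A w ++ take i w).

(** The copies of [lam] contribute [2 * K * r] by [lam_dual], the free powers of [w] contribute
    [(A - K) * r], and the two pieces of [w] together [r]. *)
Lemma rot_content i q : i <= size w -> q < b ->
  ct (hw b (drop i w ++ pow K w)) q +
  ct (hw b (pow A w ++ take i w)) (b.-1 - q) = (K + A).+1 * r.
Proof.
move=> iw qb; have qb' : b.-1 - q < b by lia.
rewrite ct_hw_drop_pow // -{1}(subnKC KA) powD -catA hw_pow_take_stable !ct_cat.
rewrite ct_pow bal //.
have : ct w (b.-1 - q) = ct (take i w) (b.-1 - q) + ct (drop i w) (b.-1 - q).
  by rewrite -ct_cat cat_take_drop.
rewrite bal // => e; have := lam_dual qb; rewrite -mulnA mul2n mulSn mulnDl mulnBl.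
by have : K * r <= A * r; [rewrite leq_mul2r KA orbT | lia].
Qed.

Lemma promote_rot i : i < size w -> promote (rot_word i) = rot_word i.+1.
Proof.
move=> iw; have wi : nth 0 w i < b by apply: (allP wb); apply: mem_nth.
have db j : all (gtn b) (drop j w) by apply/allP => x /mem_drop /(allP wb).
have tb j : all (gtn b) (take j w) by apply/allP => x /mem_take /(allP wb).
rewrite /rot_word (drop_nth 0 iw) (take_nth 0 iw) -rcons_cat.
apply: (@promote_split b _ _ _ ((K + A).+1 * r)) => //.
- by rewrite all_cat db all_pow.
- by rewrite all_cat tb all_pow.
- by move=> q qb; rewrite -cat_cons -drop_nth // rot_content // ltnW.
by move=> q qb; rewrite rcons_cat -take_nth // rot_content.
Qed.

(** Stabilization frees one copy of [w] from the left factor, its dual frees [A - K] copies from the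
    right one. In [rot_word_size] all of them come from the right. *)
Lemma rot_word0 : rot_word 0 = hw b (pow K w) ++ pow (A - K).+1 w ++ lw b (pow K w).
Proof.
rewrite /rot_word drop0 take0 cats0 -powS powSr stab -{1}(subnKC KA) lw_pow_stable.
by rewrite powS -!catA.
Qed.

Lemma rot_word_size : rot_word (size w) = rot_word 0.
Proof.
rewrite rot_word0 /rot_word drop_size take_size -powSr cat0s.
by rewrite -{1}(subnKC KA) -addnS lw_pow_stable.
Qed.

Local Notation word := (hw b (pow K w) ++ pow (A - K).+1 w ++ lw b (pow K w)).

Lemma iter_promote_word : iter (size w) promote word = word.
Proof.
have it i : i <= size w -> iter i promote (rot_word 0) = rot_word i.
  by elim: i => // i IH iw; rewrite iterS IH ?promote_rot // ltnW.
by rewrite -rot_word0 it // rot_word_size.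
Qed.

Lemma word_lattice : lattice b (fun=> 0) word.
Proof.
have db : all (gtn b) (drop 0 w ++ pow K w) by rewrite drop0 all_cat wb all_pow.
have tb : all (gtn b) (star b (pow A w ++ take 0 w)).
  by rewrite take0 cats0 all_star ?all_pow.
rewrite -rot_word0; apply/lattice_cat; split; first exact: hw_lattice.
apply: lattice_star (hw_lattice tb) _ => q qb.
rewrite /addw !add0n ct_hw_star ?rot_content //; last by lia.
by rewrite take0 cats0 all_pow.
Qed.

Lemma ct_word q : q < b -> ct word q = (K + A).+1 * r.
Proof.
move=> qb; have qb' : b.-1 - q < b by lia.
rewrite -rot_word0 ct_cat /lw ct_star ?all_hw ?all_star //.
  by rewrite ct_hw_star ?rot_content // take0 cats0 all_pow.
all: by rewrite take0 cats0 all_pow.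
Qed.

End Rotation.
End Stable.

(** * Tableaux as row words *)

(* The positions, counted from [t], of the letter [q]: row [q] of the tableau whose
   [x]-th entry lies in the row given by the [x]-th letter. *)
Fixpoint pos t q (u : seq nat) : seq nat :=
  if u is x :: u' then
    (if x == q then [:: t] else [::]) ++ pos t.+1 q u'
  else [::].

Definition rows b u := [seq pos 1 q u | q <- iota 0 b].

Definition fill b (m : nat -> nat) u : filling :=
  [seq nseq (m q) None ++ map Some (pos 1 q u) | q <- iota 0 b].

Lemma pos_cat t q u v : pos t q (u ++ v) = pos t q u ++ pos (t + size u) q v.
Proof. by elim: u t => [|x u IH] t /=; rewrite ?addn0 // IH catA addSnnS. Qed.

Lemma pos_shift s t q u : pos (s + t) q u = map (addn s) (pos t q u).
Proof. by elim: u t => //= x u IH t; rewrite map_cat -IH addnS; case: eqP. Qed.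

Lemma size_pos t q u : size (pos t q u) = ct u q.
Proof.
by elim: u t => // x u IH t; rewrite ct_cons -(IH t.+1) /= size_cat; case: eqP.
Qed.

Lemma mem_pos t q u x : x \in pos t q u -> t <= x < t + size u.
Proof.
elim: u t => //= y u IH t; rewrite mem_cat => /orP[|/IH]; last by lia.
by case: eqP => // _; rewrite inE => /eqP->; lia.
Qed.

Lemma nth_pos_ge t q u i x : nth None (map Some (pos t q u)) i = Some x -> t <= x.
Proof.
case: (ltnP i (size (pos t q u))) => h; last by rewrite nth_default ?size_map.
rewrite (nth_map 0) // => -[<-].
by have /mem_pos/andP[] := mem_nth 0 h.
Qed.

Lemma nth_map_iota (T : Type) (d : T) (f : nat -> T) b p :
  nth d (map f (iota 0 b)) p = if p < b then f p else d.
Proof.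
case: ltnP => pb; last by rewrite nth_default // size_map size_iota.
by rewrite (nth_map 0) ?size_iota // nth_iota.
Qed.

Lemma set_nth_iota (T : Type) (d : T) (f : nat -> T) b p v : p < b ->
  set_nth d (map f (iota 0 b)) p v =
  map (fun q => if q == p then v else f q) (iota 0 b).
Proof.
move=> pb; apply: (@eq_from_nth _ d).
  by rewrite size_set_nth !size_map size_iota; apply/maxn_idPr.
move=> i; rewrite size_set_nth size_map size_iota (maxn_idPr pb) => ib.
by rewrite nth_set_nth /= !nth_map_iota ib.
Qed.

Lemma set_nth_size (T : Type) (d : T) s h s' v :
  set_nth d (s ++ h :: s') (size s) v = s ++ v :: s'.
Proof. by elim: s => //= y s ->. Qed.

Lemma sumn_map_iota (f : nat -> nat) b : sumn (map f (iota 0 b)) = \sum_(q < b) f q.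
Proof. by rewrite sumnE big_map -(big_mkord xpredT) /index_iota subn0. Qed.

(* A slide under way: rows end with [base], the hole [h] sits at the end of the
   base of row [p], and the entries from [t] on have not been reached. *)
Definition conf b (base : nat -> seq (option nat)) p h t u : filling :=
  [seq base q ++ (if q == p then [:: h] else [::]) ++ map Some (pos t q u)
  | q <- iota 0 b].

Definition push (base : nat -> seq (option nat)) y t : nat -> seq (option nat) :=
  fun q => base q ++ (if y == q then [:: Some t] else [::]).

Lemma size_push base sigma y t q : size (base q) = sigma q ->
  size (push base y t q) = addc sigma y q.
Proof. by rewrite /push /addc size_cat => ->; case: eqP. Qed.

Lemma setT_conf b base p h t u v : p < b ->
  Defs.setT (conf b base p h t u) p (size (base p)) v = conf b base p v t u.
Proof.
move=> pb; rewrite /Defs.setT {2}/conf nth_map_iota pb eqxx set_nth_size set_nth_iota //.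
by apply: eq_map => q; case: eqP => [->|].
Qed.

(** If [x = p], the hole has been filled with [t] and joins the base, while the former cell of [t]
    becomes the hole. *)
Lemma conf_push b base p h t x u : (x = p -> h = Some t) ->
  conf b base p h t (x :: u) = conf b (push base x t) p h t.+1 u.
Proof.
move=> hx; apply: eq_map => q; rewrite /push /= map_cat -catA; congr cat.
case: (eqVneq q p) => [->|_] /=; last by case: eqP.
by case: (eqVneq x p) => [/hx->|].
Qed.

Lemma conf_drop b base p t u :
  conf b base p (Some t) t (p.+1 :: u) =
  conf b (push base p t) p.+1 (Some t) t.+1 u.
Proof.
apply: eq_map => q; rewrite /push /= map_cat -catA; congr cat.
rewrite [p == q]eq_sym [p.+1 == q]eq_sym.
case: (eqVneq q p) => [->|_] /=; last by case: eqP.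
by decide_eqs.
Qed.

Lemma slideS f T i j : slide f.+1 T i j =
  match getT T i j.+1, getT T i.+1 j with
  | None, None => (T, (i, j))
  | Some x, None => slide f (Defs.setT T i j (Some x)) i j.+1
  | None, Some y => slide f (Defs.setT T i j (Some y)) i.+1 j
  | Some x, Some y =>
      if x < y then slide f (Defs.setT T i j (Some x)) i j.+1
      else slide f (Defs.setT T i j (Some y)) i.+1 j
  end.
Proof. by []. Qed.

(** Entries are read in increasing order. The hole moves right at a letter [p], down at a letter
    [p.+1] if the two rows of the base have equal length, and otherwise waits. It keeps a stale
    value, hence the unspecified [h']. *)
Lemma slide_conf b f base sigma p h t u : p < b -> dominant b sigma ->
  lattice b (addc sigma p) u -> (forall q, q < b -> size (base q) = sigma q) ->
  size u <= f ->
  exists h' t', let r := glide sigma p u in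
    let base' := fun q => base q ++ map Some (pos t q r.1) in
    slide f (conf b base p h t u) p (size (base p)) =
    (conf b base' r.2 h' t' [::], (r.2, size (base' r.2))).
Proof.
have right base0 p0 h0 t0 u0 : p0 < b ->
    getT (conf b base0 p0 h0 t0 u0) p0 (size (base0 p0)).+1 =
    nth None (map Some (pos t0 p0 u0)) 0.
  move=> pb; rewrite /getT nth_map_iota pb eqxx nth_cat ltnNge leqW //=.
  by rewrite subSn // subnn.
have below base0 p0 h0 t0 u0 j : getT (conf b base0 p0 h0 t0 u0) p0.+1 j =
    if p0.+1 < b then nth None (base0 p0.+1 ++ map Some (pos t0 p0.+1 u0)) j else None.
  rewrite /getT nth_map_iota; case: ifP => _; last by rewrite nth_nil.
  by rewrite gtn_eqF.
elim: u f base sigma p h t => [|x u IH] f base sigma p h t pb d lu sz fu.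
  exists h, t => /=; have e : (fun q => base q ++ [::]) = base.
    by apply: functional_extensionality => q; rewrite cats0.
  rewrite e cats0; case: f fu => [|f] _ //; rewrite slideS right // below /=.
  by case: ifP => // pb1; rewrite cats0 nth_default // !sz //; apply: d.
case: lu => d1 [xb lu].
have [d2 pb2] := glide_step pb xb d (lattice_dominant lu).
have e := addc_glide sigma p x; move: d2 pb2 e => /=.
set c := andb _ _; set y := if c then p else x.
set p1 := if c then p.+1 else p => d2 pb2 e; rewrite -e in lu.
have sz1 q : q < b -> size (push base y t q) = addc sigma y q.
  by move=> qb; apply/size_push/sz.
(* It suffices to read one letter; fuel is spent only when the hole moves. *)
suff [f' [h1 [uf ->]]] : exists f' h1, size u <= f' /\
    slide f (conf b base p h t (x :: u)) p (size (base p)) =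
    slide f' (conf b (push base y t) p1 h1 t.+1 u) p1 (size (push base y t p1)).
  have [h' [t' /= ->]] := IH f' _ _ p1 h1 t.+1 pb2 d2 lu sz1 uf.
  exists h', t'; set r := glide _ _ _.
  have eb : (fun q => push base y t q ++ map Some (pos t.+1 q r.1)) =
            (fun q => base q ++ map Some ((if y == q then [:: t] else [::]) ++ pos t.+1 q r.1)).
    apply: functional_extensionality => q; rewrite /push map_cat catA.
    by case: eqP.
  by move: (congr1 (fun g => size (g r.2)) eb) => /= <-; rewrite eb.
case: (eqVneq x p) => [xp|nxp].
  subst x; have yp : y = p by rewrite /y; case: ifP.
  have p1p : p1 = p by rewrite /p1 /c; decide_eqs.
  case: f fu => // f fu; exists f, (Some t); split=> //.
  have lt z : getT (conf b base p h t (p :: u)) p.+1 (size (base p)) = Some z -> t < z.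
    rewrite below; case: ifP => // pb1.
    rewrite nth_cat !sz // ltnNge d //= (_ : p == p.+1 = false); last by lia.
    exact: nth_pos_ge.
  rewrite yp p1p slideS right // [pos t p _]/= eqxx /=.
  rewrite (size_push _ _ (sz p pb)) /addc eqxx addn1 -(sz p pb).
  case: (getT _ _ _) lt => [z /(_ z erefl) ->|_];
    by rewrite setT_conf // conf_push.
case: (boolP c) => hc; last first.
  have yx : y = x by rewrite /y (negbTE hc).
  have pp : p1 = p by rewrite /p1 (negbTE hc).
  exists f, h; split; first exact: ltnW.
  rewrite yx pp conf_push; last by move=> xp; rewrite xp eqxx in nxp.
  by rewrite (size_push _ _ (sz p pb)) /addc (negbTE nxp) addn0 sz.
have yp : y = p by rewrite /y hc.
have pp : p1 = p.+1 by rewrite /p1 hc.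
move: hc => /andP[/eqP xp /eqP sp]; subst x.
case: f fu => // f fu; exists f, (Some t); split=> //.
have E : getT (conf b base p h t (p.+1 :: u)) p.+1 (size (base p)) = Some t.
  by rewrite below xb nth_cat !sz // sp ltnn subnn /= eqxx.
rewrite yp pp slideS right // E setT_conf // conf_drop.
rewrite (size_push _ _ (sz _ xb)) /addc (_ : p == p.+1 = false); last by lia.
rewrite addn0 sp -(sz p pb) [pos t p _]/= (_ : p.+1 == p = false); last by lia.
case E' : (nth _ _ _) => [z|] //.
by move/nth_pos_ge: E' => tz; rewrite ltnNge ltnW.
Qed.

(** * Rectification and powers of fillings *)

Lemma mu_nseq n (s : seq nat) : Defs.mu (nseq n None ++ map Some s) = n.
Proof.
rewrite /Defs.mu find_cat has_nseq andbF size_nseq.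
by case: s => [|x s] /=; rewrite addn0.
Qed.

Lemma entries_nseq n (s : seq nat) : entries (nseq n None ++ map Some s) = s.
Proof.
rewrite /entries pmap_cat; have -> : pmap id (nseq n None) = [::] :> seq nat by elim: n.
exact: (map_pK (fun=> erefl)).
Qed.

Lemma size_fill b m u : size (fill b m u) = b.
Proof. by rewrite size_map size_iota. Qed.

Lemma nth_fill b m u p : p < b ->
  nth [::] (fill b m u) p = nseq (m p) None ++ map Some (pos 1 p u).
Proof. by move=> pb; rewrite nth_map_iota pb. Qed.

Lemma entries_fill b m u : map entries (fill b m u) = rows b u.
Proof. by rewrite -map_comp; apply: eq_map => q /=; rewrite entries_nseq. Qed.

Lemma sumn_size_fill b m u :
  sumn (map size (fill b m u)) = \sum_(q < b) (m q + ct u q).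
Proof.
rewrite -map_comp sumn_map_iota; apply: eq_bigr => q _ /=.
by rewrite size_cat size_nseq size_map size_pos.
Qed.

Lemma size_fuelT b m u : all (gtn b) u -> size u <= fuelT (fill b m u).
Proof.
move=> ub; rewrite /fuelT sumn_size_fill big_split /= sum_ct //; lia.
Qed.

Lemma count_inner_fill b m u : count_inner (fill b m u) = \sum_(q < b) m q.
Proof.
rewrite /count_inner -map_comp sumn_map_iota; apply: eq_bigr => q _ /=.
rewrite count_cat count_nseq /= mul1n -[RHS]addn0; congr addn.
by elim: pos.
Qed.

Lemma fill_conf b m p u : 0 < m p ->
  fill b m u = conf b (fun q => nseq (decc m p q) None) p None 1 u.
Proof.
move=> mp; apply: eq_map => q; rewrite /decc eq_sym; case: eqP => [->|_].
  by rewrite -[in LHS](prednK mp) subn1 catA -[[:: None]]/(nseq 1 None) -nseqD addn1.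
by rewrite subn0.
Qed.

Lemma remove_cell_conf b base p h t : p < b ->
  remove_cell (conf b base p h t [::]) p (size (base p)) = map base (iota 0 b).
Proof.
move=> pb; rewrite /remove_cell nth_map_iota pb take_size_cat // set_nth_iota //.
by apply: eq_map => q; case: eqP => [->|] //=; rewrite cats0.
Qed.

(** Each pass is one [glide] from the lowest inner corner and preserves [hw]; once the inner shape
    is empty, the word is its own [hw]. *)
Lemma rect_fuel_fill b m u f : lattice b m u -> \sum_(q < b) m q < f ->
  rect_fuel f (fill b m u) = fill b (fun=> 0) (hw b u).
Proof.
elim: f m u => // f IH m u lu; rewrite ltnS => sf /=.
rewrite size_fill.
have -> : [seq i <- iota 0 b | 0 < Defs.mu (nth [::] (fill b m u) i)] =
          [seq i <- iota 0 b | 0 < m i].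
  by apply: eq_in_filter => i; rewrite mem_iota => /andP[_ ib]; rewrite nth_fill // mu_nseq.
have := filter_iota_last (fun i => 0 < m i) b.
case: filter => [|i0 idx] /=.
  move=> m0; have e q : q < b -> m q = 0 by move/m0; lia.
  have l0 : lattice b (fun=> 0) u by apply: lattice_ext lu => p /e.
  by rewrite hw_id //; apply/eq_in_map => q; rewrite mem_iota => /e->.
move: (last i0 idx) => p [pb mp mq].
have [l1 l2 l3 l4] := rect_step pb mp mq lu.
rewrite nth_fill // mu_nseq.
have [d e] := decc_corner pb mp mq (lattice_dominant lu).
have szb q : q < b -> size (nseq (decc m p q) (@None nat)) = decc m p q.
  by rewrite size_nseq.
have lu' : lattice b (addc (decc m p) p) u by rewrite e.
have [h' [t' /= sl]] := @slide_conf b _ _ _ p None 1 u pb d lu' szb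
  (size_fuelT m (lattice_lt lu)).
have dp : decc m p p = (m p).-1 by rewrite /decc eqxx subn1.
move: sl; rewrite size_nseq dp -fill_conf // => ->.
rewrite /= remove_cell_conf // -l3; apply: IH l1 _.
by have := sum_decc pb mp; lia.
Qed.

Lemma Rect_fill b m u : lattice b m u -> Rect (fill b m u) = rows b (hw b u).
Proof.
by move=> lu; rewrite /Rect rect_fuel_fill ?count_inner_fill // entries_fill.
Qed.

Lemma ncells_fill b m u : all (gtn b) u -> ncells (fill b m u) = size u.
Proof.
move=> ub; rewrite /ncells (map_comp size entries) entries_fill -map_comp sumn_map_iota.
by rewrite -(sum_ct ub); apply: eq_bigr => q _; rewrite /= size_pos.
Qed.

Lemma pos_pow q u k :
  pos 1 q (pow k u) = flatten [seq map (addn (j * size u)) (pos 1 q u) | j <- iota 0 k].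
Proof.
elim: k => // k IH; rewrite powSr pos_cat IH.
have -> : iota 0 k.+1 = iota 0 k ++ [:: k] by rewrite -addn1 iotaD.
rewrite map_cat flatten_cat; congr cat.
by rewrite /= cats0 size_pow addnC pos_shift.
Qed.

Lemma rep_rows_fill b m u k : all (gtn b) u ->
  rep_rows (fill b m u) k = rows b (pow k u).
Proof.
move=> ub; rewrite /rep_rows -map_comp; apply: eq_map => q /=.
by rewrite pos_pow ncells_fill // entries_nseq.
Qed.

Lemma Spow_fill b m u k : all (gtn b) u -> Spow (fill b m u) k = fill b m (pow k u).
Proof.
move=> ub; rewrite /Spow rep_rows_fill // zip_map -map_comp; apply: eq_map => q /=.
by rewrite mu_nseq.
Qed.

Lemma mem_pos_nth t q u i : i < size u -> (t + i \in pos t q u) = (nth 0 u i == q).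
Proof.
elim: u t i => // x u IH t [|i] iu /=; rewrite mem_cat.
  rewrite addn0; case: eqP => _; rewrite ?inE ?eqxx //=.
  by apply/negP => /mem_pos; rewrite ltnn.
rewrite -addSnnS IH //; case: eqP => _ //=; rewrite inE.
by rewrite (_ : t.+1 + i == t = false) //; lia.
Qed.

Lemma rowof_rows b u i : all (gtn b) u -> i < size u -> rowof (rows b u) i.+1 = nth 0 u i.
Proof.
move=> ub iu; have xb : nth 0 u i < b by apply: (allP ub); apply: mem_nth.
rewrite /rowof find_map (eq_find (a2 := pred1 (nth 0 u i))); last first.
  by move=> q /=; rewrite -add1n mem_pos_nth // eq_sym.
rewrite -[find _ _]/(index (nth 0 u i) (iota 0 b)).
by rewrite -[X in index X _](nth_iota 0 0 xb) index_uniq ?iota_uniq ?size_iota.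
Qed.

Lemma pos_rcons t q u x :
  pos t q (rcons u x) = pos t q u ++ (if x == q then [:: t + size u] else [::]).
Proof. by rewrite -cats1 pos_cat /= cats0. Qed.

Lemma pos_star b q u : q < b -> all (gtn b) u ->
  pos 1 q (star b u) = map (fun x => (size u).+1 - x) (rev (pos 1 (b.-1 - q) u)).
Proof.
move=> qb; elim/last_ind: u => [|u x IH] //; rewrite all_rcons => /andP[/= xb ub].
have -> : star b (rcons u x) = (b.-1 - x) :: star b u by rewrite -cats1 star_cat.
rewrite pos_rcons rev_cat map_cat size_rcons /=; congr cat.
  rewrite (_ : (b.-1 - x == q) = (x == b.-1 - q)); last by lia.
  by case: eqP => //= _; rewrite add1n subSnn.
rewrite -[2]/(1 + 1) pos_shift (IH ub) -map_comp; apply/eq_in_map => y.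
by rewrite mem_rev => /mem_pos/andP[_ ylt] /=; lia.
Qed.

Lemma foldr_maxn_le s x : x \in s -> x <= foldr maxn 0 s.
Proof.
elim: s => //= y s IH; rewrite inE => /orP[/eqP->|/IH h]; first exact: leq_maxl.
by apply: leq_trans h _; apply: leq_maxr.
Qed.

Lemma foldr_maxn_iota n s : perm_eq s (iota 1 n) -> foldr maxn 0 s = n.
Proof.
move=> ps; have sn x : x \in s = (1 <= x < 1 + n) by rewrite (perm_mem ps) mem_iota.
apply/eqP; rewrite eqn_leq; apply/andP; split.
  have : {in s, forall x, x <= n} by move=> x; rewrite sn; lia.
  elim: (s) => //= y s' IH h; rewrite geq_max h ?mem_head //= IH // => x xs.
  by apply: h; rewrite inE xs orbT.
by case: n sn {ps} => // n sn; apply: foldr_maxn_le; rewrite sn; lia.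
Qed.

Lemma perm_rows b u : all (gtn b) u -> perm_eq (flatten (rows b u)) (iota 1 (size u)).
Proof.
move=> ub; have mem_rows x : (x \in flatten (rows b u)) = (x \in iota 1 (size u)).
  rewrite mem_iota; apply/flattenP/idP => [[s /mapP[q _ ->]] /mem_pos //|].
  case: x => // x; rewrite add1n ltnS => /= xu.
  have xb : nth 0 u x < b by apply: (allP ub); apply: mem_nth.
  exists (pos 1 (nth 0 u x) u); last by rewrite -add1n mem_pos_nth.
  by apply: map_f; rewrite mem_iota.
have sz : size (flatten (rows b u)) = size u.
  rewrite size_flatten /shape -map_comp sumn_map_iota -(sum_ct ub).
  by apply: eq_bigr => q _; rewrite /= size_pos.
apply: uniq_perm; rewrite ?iota_uniq //.
apply: leq_size_uniq (iota_uniq 1 (size u)) _ _; last by rewrite sz size_iota.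
by move=> x; rewrite mem_rows.
Qed.

Lemma RectStar_fill b m u : lattice b m u -> RectStar (fill b m u) = rows b (lw b u).
Proof.
move=> lu; have ub := lattice_lt lu; rewrite /RectStar.
cbv zeta; set a' := foldr maxn 0 (map size _); rewrite entries_fill (foldr_maxn_iota (perm_rows ub)).
(* The rotated filling has the complement of the outer shape as its inner shape. *)
pose m' q := a' - addw m u (b.-1 - q).
have szr q : q < b -> addw m u q <= a'.
  move=> qb; apply: foldr_maxn_le; apply/mapP; exists (nth [::] (fill b m u) q).
    by rewrite mem_nth ?size_fill.
  by rewrite nth_fill // size_cat size_nseq size_map size_pos.
have -> : rev [seq nseq (a' - size row) None ++
     [seq Some ((size u).+1 - x) | x <- rev (entries row)] | row <- fill b m u] =
   fill b m' (star b u).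
  apply: (@eq_from_nth _ [::]); first by rewrite size_rev size_map !size_fill.
  move=> i; rewrite size_rev size_map size_fill => ib.
  have ib' : b - i.+1 < b by lia.
  rewrite nth_rev size_map size_fill // (nth_map [::]) ?size_fill //.
  rewrite !nth_fill //.
  rewrite entries_nseq pos_star // -map_comp size_cat size_nseq size_map size_pos.
  by have -> : b - i.+1 = b.-1 - i by lia.
rewrite Rect_fill; last first.
  by apply: (@lattice_star b a' m) => // q qb; rewrite /m' subnK // szr //; lia.
rewrite size_fill; apply/eq_in_map => i; rewrite mem_iota => /andP[_ ib].
rewrite nth_map_iota (_ : b.-1 - i < b); last by lia.
by rewrite /lw pos_star ?size_hw ?size_star // all_hw ?all_star.
Qed.

(** The shifts in [Ra] are the lengths of the preceding factors; the numerical hypothesis makes the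
    last one agree despite truncated subtraction. *)
Lemma Ra_fill b m w k a : lattice b m (pow k.-1 w) -> all (gtn b) w ->
  a + 2 - 2 * k + k.-1 = a + 1 - k ->
  Ra a (fill b m w) k =
  rows b (hw b (pow k.-1 w) ++ pow (a + 2 - 2 * k) w ++ lw b (pow k.-1 w)).
Proof.
move=> lw wb ek; rewrite /Ra size_fill; apply/eq_in_map => q.
rewrite mem_iota => /andP[_ qb].
rewrite Spow_fill // Rect_fill // RectStar_fill // rep_rows_fill // ncells_fill //.
rewrite !nth_map_iota qb !pos_cat size_hw !size_pow -ek; congr (_ ++ (_ ++ _)).
  by rewrite -pos_shift; congr pos; lia.
by rewrite -pos_shift mulnDl; congr pos; lia.
Qed.

(** * Promotion of tableaux *)

Lemma lattice_word_cons b x u : lattice b (fun=> 0) (x :: u) ->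
  x = 0 /\ lattice b (addc (fun=> 0) 0) u.
Proof. by move=> l; have x0 := lattice0_cons l; subst x; case: l => _ []. Qed.

Lemma promote_lattice b x u : 0 < b -> lattice b (fun=> 0) (x :: u) ->
  lattice b (fun=> 0) (promote (x :: u)).
Proof.
move=> b0 lx; have [x0 lu] := lattice_word_cons lx; subst x.
have d0 : dominant b (fun=> 0) by [].
have [l1 l2 l3] := glide_lattice b0 d0 lu.
rewrite /promote /= -cats1; apply/lattice_cat; split=> //.
split; first exact: lattice_end.
split=> //; rewrite l3; split=> //; exact: lattice_end.
Qed.

Lemma size_promote x u : size (promote (x :: u)) = (size u).+1.
Proof. by rewrite size_rcons size_glide. Qed.

Lemma pr_rows b x u : 0 < b -> lattice b (fun=> 0) (x :: u) ->
  pr (rows b (x :: u)) = rows b (promote (x :: u)).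
Proof.
move=> b0 lx; have [x0 lu] := lattice_word_cons lx; subst x.
have d0 : dominant b (fun=> 0) by [].
rewrite /pr.
have -> : sumn (map size (rows b (0 :: u))) = (size u).+1.
  rewrite -map_comp sumn_map_iota -[RHS]/(size (0 :: u)) -(sum_ct (lattice_lt lx)).
  by apply: eq_bigr => q _; apply: size_pos.
have ef : map (map Some) (rows b (0 :: u)) = fill b (fun=> 0) (0 :: u).
  by rewrite -map_comp.
(* The cell of the entry 1 serves as the hole on an empty base, and the unread entries start at
   2. *)
have ec : fill b (fun=> 0) (0 :: u) = conf b (fun=> [::]) 0 (Some 1) 2 u.
  by apply: eq_map => q /=; rewrite map_cat eq_sym; case: eqP.
have sf : size u <= fuelT (fill b (fun=> 0) (0 :: u)).
  by apply: leq_trans (size_fuelT _ (lattice_lt lx)).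
have [h' [t' /= sl]] :=
  @slide_conf b _ (fun=> [::]) _ 0 (Some 1) 2 u b0 d0 lu (fun _ _ => erefl) sf.
rewrite -ec in sl; rewrite ef sl /=; set r := glide _ _ _ in sl *.
have [l1 l2 l3] := glide_lattice b0 d0 lu; rewrite -/r in l1 l2 l3.
have := @setT_conf b (fun q => map Some (pos 2 q r.1)) _ h' t' [::] (Some (size u).+2) l2.
move=> /= ->; rewrite -map_comp.
apply: eq_map => q /=; rewrite cats0 map_cat -map_comp /promote /= -/r pos_rcons.
rewrite -[2]/(1 + 1) pos_shift -map_comp eq_sym; congr cat.
  by rewrite -[RHS]map_id; apply: eq_map => y.
by case: eqP => // _; rewrite size_glide.
Qed.

Lemma iter_pr_rows b u n : 0 < b -> 0 < size u -> lattice b (fun=> 0) u ->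
  iter n pr (rows b u) = rows b (iter n promote u).
Proof.
move=> b0; elim: n u => // n IH [|x u] // _ lu.
rewrite !iterSr pr_rows // IH //; first by rewrite size_promote.
exact: promote_lattice.
Qed.

(** * Standard tableaux and lattice words *)

(** The entries at most [n] fill the first [ct (take n u) q] places of row [q]; this translates
    column conditions into dominance of prefixes. *)
Lemma nth_pos_take n q u i : i < ct u q ->
  (nth 0 (pos 1 q u) i <= n) = (i < ct (take n u) q).
Proof.
move=> iu; rewrite -{1}(cat_take_drop n u) pos_cat nth_cat size_pos.
case: ltnP => h.
  have := @mem_nth _ 0 (pos 1 q (take n u)) i; rewrite size_pos => /(_ h) /mem_pos.
  case/andP=> _; rewrite size_take_min add1n ltnS => le.
  by rewrite (leq_trans le) // geq_minl.
have h2 : i - ct (take n u) q < ct (drop n u) q.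
  by move: iu; rewrite -{1}(cat_take_drop n u) ct_cat; lia.
have nu : n < size u.
  by rewrite ltnNge; apply/negP => nu; move: h2; rewrite drop_oversize ?ltn0.
rewrite size_takel ?(ltnW nu) // in h *.
have := @mem_nth _ 0 (pos (1 + n) q (drop n u)) (i - ct (take n u) q).
by rewrite size_pos => /(_ h2) /mem_pos /andP[le _]; apply/negbTE; rewrite -ltnNge.
Qed.

Lemma sorted_pos t q u : sorted ltn (pos t q u).
Proof.
elim: u t => //= x u IH t; case: eqP => _ //=; rewrite path_min_sorted //.
by apply/allP => y /mem_pos/andP[].
Qed.

Lemma SYT_rect_rows b c u : lattice b (fun=> 0) u ->
  (forall q, q < b -> ct u q = c) -> is_SYT_rect (rows b u) c b.
Proof.
move=> lu cu; have ub := lattice_lt lu; rewrite /is_SYT_rect.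
have sz : map size (rows b u) = nseq b c.
  have /all_pred1P -> : all (pred1 c) (map size (rows b u)).
    apply/allP => _ /mapP[s /mapP[q + ->] ->]; rewrite mem_iota => /andP[_ qb] /=.
    by rewrite size_pos cu.
  by rewrite !size_map size_iota.
have srt (s : seq nat) d : all (pred1 d) s -> sorted (fun x y => y <= x) s.
  case: s => //= y s /andP[/eqP-> h]; elim: s h => //= z s IH /andP[/eqP->].
  by rewrite leqnn.
have -> : map (map Some) (rows b u) = fill b (fun=> 0) u by rewrite -map_comp.
rewrite sz eqxx andbT /is_std_skew entries_fill; apply/and5P; split; last (apply/andP; split).
- apply/allP => s /mapP[q _ ->]; rewrite mu_nseq /= drop0.
  by rewrite all_map; apply/allP.
- apply: (srt _ 0); rewrite all_map; apply/allP => s /mapP[q _ ->].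
  by rewrite /= -[map _ _]/(nseq 0 None ++ map Some (pos 1 q u)) mu_nseq.
- have -> : map size (fill b (fun=> 0) u) = nseq b c.
    by rewrite -sz -!map_comp; apply: eq_map => q /=; rewrite size_map.
  by apply: (srt _ c); rewrite all_pred1_nseq.
- have := perm_rows ub; move/perm_size: (perm_rows ub); rewrite size_iota => -> //.
- apply/allP => s /mapP[q _ ->]; rewrite -[[seq _ | _ <- _]]/(nseq 0 None ++ map Some (pos 1 q u)).
  by rewrite entries_nseq sorted_pos.
apply/allP => i _; apply/allP => j _; rewrite /getT.
case: (ltnP i.+1 b) => ib; last first.
  by rewrite (@nth_default _ _ _ i.+1) ?size_fill // nth_nil; case: (nth _ _ _).
rewrite !nth_fill ?(ltnW ib) //=.
case: (ltnP j (ct u i)) => ji; last by rewrite nth_default // size_map size_pos.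
case: (ltnP j (ct u i.+1)) => ji1; last first.
  by rewrite (@nth_default _ _ (map Some (pos 1 i.+1 u))) ?size_map ?size_pos //; case: (nth _ _ _).
rewrite !(nth_map 0) ?size_pos //.
set x := nth 0 (pos 1 i u) j; set y := nth 0 (pos 1 i.+1 u) j.
have := nth_pos_take y ji1; rewrite -/y leqnn => /esym jy.
have xy : x <= y.
  rewrite /x nth_pos_take //; apply: leq_trans jy _.
  by have := lattice_end (lattice_take y lu) ib; rewrite /addw !add0n.
(* Equality is impossible, since an entry lies in only one row. *)
rewrite ltn_neqAle xy andbT; apply/eqP => exy.
have xi : x \in pos 1 i u by rewrite mem_nth ?size_pos.
have yi : x \in pos 1 i.+1 u by rewrite exy mem_nth ?size_pos.
have := mem_pos xi; case: (x) xi yi => [|x'] // xi yi x'u.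
by move: xi yi; rewrite -add1n !mem_pos_nth; lia.
Qed.

Lemma pos_map_iota t q n f :
  pos t q (map f (iota t n)) = [seq x <- iota t n | f x == q].
Proof. by elim: n t => //= n IH t; rewrite IH; case: eqP. Qed.

Lemma rowof_uniq (T : seq (seq nat)) x q : uniq (flatten T) -> q < size T ->
  (x \in nth [::] T q) = (x \in flatten T) && (rowof T x == q).
Proof.
rewrite /rowof; elim: T q => //= s T IH q; rewrite cat_uniq mem_cat.
move=> /and3P[_ /hasPn dis uT]; case: q => [|q] qT /=.
  by case: ifP => //= _; rewrite andbF.
rewrite IH //; case: ifP => //= xs; rewrite ?andbF //.
by apply/negbTE/andP => -[/dis]; rewrite xs.
Qed.

Lemma row_decomp row : all (fun o => isSome o) (drop (Defs.mu row) row) ->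
  row = nseq (Defs.mu row) None ++ map Some (entries row).
Proof.
rewrite /Defs.mu; elim: row => // -[x|] row IH; rewrite /entries /=; last first.
  by move/IH => {1}->.
move=> h; congr (_ :: _); elim: row h {IH} => // -[y|] row IH //=.
by move/IH => {1}->.
Qed.

Lemma std_skew_fill S : is_std_skew S -> exists m w,
  S = fill (size S) m w /\ lattice (size S) m w.
Proof.
rewrite /is_std_skew; cbv zeta; set E := map entries S; set b := size S.
case/and5P=> allS smu ssz pw /andP[srt col].
have uE : uniq (flatten E) by rewrite (perm_uniq pw) iota_uniq.
have szE : size E = b by rewrite size_map.
pose m q := Defs.mu (nth [::] S q).
pose w := map (rowof E) (iota 1 (size (flatten E))).
have posE q : q < b -> pos 1 q w = entries (nth [::] S q).
  move=> qb; rewrite /w pos_map_iota.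
  have nE : nth [::] E q = entries (nth [::] S q) by rewrite (nth_map [::]).
  apply: (irr_sorted_eq ltn_trans ltnn).
  - by apply: sorted_filter; [apply: ltn_trans | apply: iota_ltn_sorted].
  - by move/allP: srt; apply; rewrite mem_nth.
  by move=> x; rewrite mem_filter -(perm_mem pw) -nE rowof_uniq ?szE // andbC.
have ES : S = fill b m w.
  apply: (@eq_from_nth _ [::]); first by rewrite size_fill.
  move=> q qb; rewrite nth_fill // posE //; apply: row_decomp.
  by move/allP: allS; apply; rewrite mem_nth.
exists m, w; split=> //.
have wb : all (gtn b) w.
  apply/allP => _ /mapP[x xi ->] /=; move: xi; rewrite -(perm_mem pw).
  by case/flattenP=> s sE xs; rewrite -szE -has_find; apply/hasP; exists s.
apply: latticeP => // n p pb; rewrite /addw leqNgt; apply/negP.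
(* If row [p.+1] overhangs row [p] after [n] letters, column [j] holds an entry at most [n] below an
   entry larger than [n]. *)
set j := m p + _ => jlt.
have mp : m p.+1 <= m p.
  have := sortedP 0 smu; rewrite size_map => /(_ p pb).
  by rewrite !(nth_map [::]) // ltnW.
have sp : m p.+1 + ct w p.+1 <= m p + ct w p.
  have := sortedP 0 ssz; rewrite size_map => /(_ p pb).
  rewrite !(nth_map [::]) ?(ltnW pb) // ES !nth_fill ?(ltnW pb) //.
  by rewrite !size_cat !size_nseq !size_map !size_pos.
have take_le q : ct (take n w) q <= ct w q.
  by rewrite -[in X in _ <= X](cat_take_drop n w) ct_cat leq_addr.
have h1 : j - m p.+1 < ct (take n w) p.+1 by rewrite /j; lia.
have h2 : j - m p.+1 < ct w p.+1 by apply: leq_trans h1 (take_le _).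
have h3 : ct (take n w) p < ct w p by have := take_le p.+1; rewrite /j in jlt *; lia.
have := nth_pos_take n h2; rewrite h1 => yn.
have := nth_pos_take n h3; rewrite ltnn => xn.
move/allP: col => /(_ p); rewrite mem_iota /= (ltnW pb) => /(_ isT) /allP /(_ j).
rewrite mem_iota /= add0n /getT {1 2 3}ES !nth_fill ?(ltnW pb) //.
rewrite size_cat size_nseq size_map size_pos !nth_cat !size_nseq.
have -> : j < m p.+1 + ct w p.+1 by have := take_le p.+1; lia.
have -> : (j < m p) = false by rewrite /j; lia.
have -> : (j < m p.+1) = false by rewrite /j; lia.
have -> : j - m p = ct (take n w) p by rewrite /j addKn.
rewrite !(nth_map 0) ?size_pos // => /(_ isT).
lia.
Qed.

(** The row of an entry is a letter of the row word, so the condition compares the last blocks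
    letter by letter. *)
Lemma stabilizes_hw b m w K : lattice b m (pow K.+1 w) -> all (gtn b) w ->
  stabilizes (fill b m w) K.+1 -> hw b (pow K w ++ w) = hw b (pow K w) ++ w.
Proof.
move=> lk wb; rewrite /stabilizes Spow_fill // Rect_fill // rep_rows_fill //.
rewrite ncells_fill // subn1 => /allP st.
have [z sz e] := hw_cat_prefix b (pow K w) w; rewrite e; congr cat.
apply: (@eq_from_nth _ 0) => // i; rewrite sz => iw.
have pb : all (gtn b) (pow K.+1 w) by apply: all_pow.
have isz : K * size w + i < size (pow K.+1 w) by rewrite size_pow mulSn; lia.
have /st : (K * size w + i).+1 \in iota (K * size w).+1 (size w).
  by rewrite mem_iota; lia.
rewrite !rowof_rows ?all_hw ?size_hw // powSr e => /eqP.
by rewrite !nth_cat size_hw size_pow ltnNge leq_addr /= addKn.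
Qed.

Theorem mainTheorem12 (b r : nat) (S : filling) (k a : nat) :
  1 <= b -> 1 <= r ->
  is_std_skew S -> size S = b ->
  all (fun row => size (entries row) == r) S ->
  (* k = stab(S) *)
  1 <= k -> stabilizes S k ->
  (forall k', 1 <= k' < k -> ~~ stabilizes S k') ->
  2 * k - 1 <= a ->
  is_SYT_rect (Ra a S k) (a * r) b /\ iter (b * r) pr (Ra a S k) = Ra a S k.
Proof.
move=> b1 r1 /std_skew_fill[m [w [eS lw]]] sS; rewrite sS in eS lw.
rewrite {S sS}eS => rowr k1 + _ ka; case: k k1 ka => // K _ ka.
have wb := lattice_lt lw.
have bal q : q < b -> ct w q = r.
  move=> qb; move/allP: rowr => /(_ (nth [::] (fill b m w) q)).
  by rewrite mem_nth ?size_fill // nth_fill // entries_nseq size_pos => /(_ isT)/eqP.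
have sw : size w = b * r.
  rewrite -(sum_ct wb) (eq_bigr (fun=> r)) => [|q _]; last exact: bal.
  by rewrite sum_nat_const card_ord.
have lk N : lattice b m (pow N w) := lattice_pow N bal lw.
move=> /(stabilizes_hw (lk _) wb) stab.
(* Here [a - K.+1] is taken for [A], and the lower bound on [a] becomes [K <= A]. *)
have KA : K <= a - K.+1 by lia.
have ea : (K + (a - K.+1)).+1 = a by lia.
have ek : a + 2 - 2 * K.+1 = (a - K.+1 - K).+1 by lia.
have eR : a + 2 - 2 * K.+1 + K.+1.-1 = a + 1 - K.+1 by lia.
rewrite Ra_fill // ek [K.+1.-1]/=.
have wl := word_lattice wb bal stab KA.
have wc q qb := @ct_word _ _ _ _ wb bal stab _ KA q qb.
split; first by apply: SYT_rect_rows => // q qb; rewrite wc // ea.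
rewrite iter_pr_rows // -?sw ?(iter_promote_word wb bal stab KA) //.
(* The word is nonempty because row 0 has [a * r] cells. *)
rewrite lt0n size_eq0; apply/eqP => e0; have := wc 0 b1.
by rewrite e0 ea => /esym/eqP; rewrite muln_eq0; lia.
Qed.
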